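(* In the setting of the context, consider two systems $(c,p)$ and $(\bar c,\bar p)$ on the same spaces $X,A$, with the same initial measure $\mu_0$ and discount factor $\beta$, each satisfying the assumptions of the context. For each $T$ let $(\pi^T_t,\mu^T_t)_{t=0}^{T-1}$ and $(\bar\pi^T_t,\bar\mu^T_t)_{t=0}^{T-1}$ be mean-field equilibria of the $T$-horizon games $(X,A,c,p,\mu_0,T)$ and $(X,A,\bar c,\bar p,\mu_0,T)$, and let $\varepsilon>0$ be such that, for all sufficiently large $T$, $W_1(\pi^T_t\otimes\mu^T_t,\bar\pi^T_t\otimes\bar\mu^T_t)<\varepsilon$ for all $t$. Extend both equilibria to infinite flows (same notation). Suppose that as $T\to\infty$, in $\prod_{t\ge0}\mathcal P(X\times A)$ with the product of weak topologies, $(\pi^T_t\otimes\mu^T_t)_t\to(\pi_t\otimes\mu_t)_t$ and $(\bar\pi^T_t\otimes\bar\mu^T_t)_t\to(\bar\pi_t\otimes\bar\mu_t)_t$, where $(\pi_t,\mu_t)_t$ and $(\bar\pi_t,\bar\mu_t)_t$ are asymptotically discount optimal mean-field equilibria of the respective non-stationary games. Let $\pi\otimes\mu=\lim_t\pi_t\otimes\mu_t$ and $\bar\pi\otimes\bar\mu=\lim_t\bar\pi_t\otimes\bar\mu_t$. Then $(\pi,\mu)$ is a mean-field equilibrium of the stationary game $(X,A,c,p)$, $(\bar\pi,\bar\mu)$ is a mean-field equilibrium of the stationary game $(X,A,\bar c,\bar p)$, and $$W_1(\pi\otimes\mu,\bar\pi\otimes\bar\mu)<3\varepsilon.$$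
   Context: $(X,d_X)$ is a compact metric space, $A$ a compact convex subset of some $\mathbb R^m$, $\beta\in[0,1)$, $\mu_0\in\mathcal P(X)$. $W_1$ is the 1-Wasserstein metric, metrizing weak convergence on $\mathcal P(X)$ and $\mathcal P(X\times A)$. Assumptions on a system $c:X\times A\times\mathcal P(X)\to\mathbb R$, $p:X\times A\times\mathcal P(X)\to\mathcal P(X)$: (i) if $(x_n,a_n,\mu_n)\to(x,a,\mu)$ in $X\times A\times\mathcal P(X)$, then $c(x_n,a_n,\mu_n)\to c(x,a,\mu)$ and $p(\cdot|x_n,a_n,\mu_n)\to p(\cdot|x,a,\mu)$ weakly; (ii) there are constants $\tilde L_1,\tilde K_1$ with $|c(x,a,\mu)-c(\hat x,a,\mu)|\le\tilde L_1d_X(x,\hat x)$ and $W_1(p(\cdot|x,a,\mu),p(\cdot|\hat x,a,\mu))\le\tilde K_1d_X(x,\hat x)$ for all $x,\hat x,a,\mu$; (iii) $\beta\tilde K_1<1$. A policy is a stochastic kernel $\pi:X\to\mathcal P(A)$; $\pi\otimes\mu(da,dx):=\pi(da|x)\mu(dx)$. A mean-field equilibrium of the $T$-horizon game $(X,A,c,p,\mu_0,T)$ is a pair of flows $(\pi^T_t)_{t=0}^{T-1}$, $(\mu^T_t)_{t=0}^{T-1}$ with $\mu^T_0=\mu_0$ such that (1) $(\pi^T_t)_t$ minimizes $E[\sum_{t=0}^{T-1}\beta^tc(x_t,a_t,\mu^T_t)]$ over Markov policies, where $x_0\sim\mu_0$, $a_t\sim\pi_t(\cdot|x_t)$, $x_{t+1}\sim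 p(\cdot|x_t,a_t,\mu^T_t)$, and (2) $\mu^T_{t+1}(\cdot)=\int_X\int_A p(\cdot|x,a,\mu^T_t)\pi^T_t(da|x)\mu^T_t(dx)$. A mean-field equilibrium of the infinite-horizon non-stationary game $(X,A,c,p,\mu_0)$ is the analogous pair $((\pi_t)_{t\ge0},(\mu_t)_{t\ge0})$ with $T$ replaced by $\infty$. A mean-field equilibrium of the stationary game $(X,A,c,p)$ is a pair $(\pi,\mu)$ such that the constant flows $(\pi,\pi,\dots),(\mu,\mu,\dots)$ form a mean-field equilibrium of the non-stationary game with initial measure $\mu$. A $T$-horizon equilibrium is extended to an infinite flow by setting $(\pi^T_t,\mu^T_t):=(\pi^T_{T-1},\mu^T_{T-1})$ for $t\ge T$. An asymptotically discount optimal mean-field equilibrium is a mean-field equilibrium $(\hat\pi_t,\hat\mu_t)_{t\ge0}$ of the non-stationary game such that $\lim_{t\to\infty}\hat\pi_t\otimes\hat\mu_t=\pi\otimes\mu$ exists in $(\mathcal P(X\times A),W_1)$ for some mean-field equilibrium $(\pi,\mu)$ of the stationary game. *)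

(* Defs.v *)
From HB Require Import structures.
From mathcomp Require Import all_boot all_order all_algebra.
From mathcomp Require Import all_classical all_reals all_analysis.

Set Implicit Arguments.
Unset Strict Implicit.
Unset Printing Implicit Defensive.

Import Order.TTheory GRing.Theory Num.Theory.
Import numFieldNormedType.Exports.

Local Open Scope classical_set_scope.
Local Open Scope ring_scope.

#[short(type="topMeasurableType")]
HB.structure Definition TopMeasurable (d : measure_display) :=
  { T of Topological T & Measurable d T }.
HB.saturate prod.

(* The space [T] with its topology and its Borel sigma-algebra.  Measurable
   types are pointed in the library; [t0] only supplies that point. *)
Definition borel (T : topologicalType) (t0 : T) : Type := T.

Section borel_instances.
Context (T : topologicalType) (t0 : T).

HB.instance Definition _ := Topological.on (borel t0).
HB.instance Definition _ := isPointed.Build (borel t0) t0.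

Let borel_measurable : set (set (borel t0)) := <<s @open T >>.

HB.instance Definition _ := @isMeasurable.Build (sigma_display (@open T))
  (borel t0) borel_measurable (@sigma_algebra0 _ setT (@open T))
  (@sigma_algebraC (borel t0) (@open T))
  (@sigma_algebra_bigcup _ setT (@open T)).

End borel_instances.



Section weak_topology.
Context d (T : topMeasurableType d) (R : realType).

Definition bounded_continuous : Type :=
  {f : T -> R | continuous f /\ exists M, forall x, `|f x| <= M}.

(* The set of probability measures on [T] with the topology of weak
   convergence: the coarsest one making every [mu |-> \int f dmu] continuous. *)
Definition weak_probability : Type :=
  initial_topology (fun mu : probability T R =>
    (fun f => \int[mu]_x sval f x) : {ptws bounded_continuous -> R}).

HB.instance Definition _ := Topological.on weak_probability.

End weak_topology.

Section wasserstein.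
Context d (T : measurableType d) (R : realType) (dist : T -> T -> R).

Definition coupling (mu nu : probability T R) (g : probability (T * T)%type R) :=
  forall B, measurable B ->
    g (B `*` [set: T]) = mu B /\ g ([set: T] `*` B) = nu B.

Definition W1 (mu nu : probability T R) : \bar R :=
  ereal_inf [set \int[g]_z (dist z.1 z.2)%:E | g in coupling mu nu]%E.

End wasserstein.

Section kernel_product.
Context d d' (X : measurableType d) (Y : measurableType d') (R : realType).
Variables (pi : R.-pker X ~> Y) (mu : probability X R).

(* [pi (x) mu], as a measure on [X * Y]: C |-> \int pi(C_x | x) mu(dx). *)
Definition kjoint (C : set (X * Y)%type) : \bar R :=
  (\int[mu]_x pi x (xsection C x))%E.

Let kjoint0 : kjoint set0 = 0%E.
Proof. by apply: integral0_eq => x _; rewrite xsection0 measure0. Qed.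

Let kjoint_ge0 C : (0 <= kjoint C)%E.
Proof. exact: integral_ge0. Qed.

Let kjoint_sigma_additive : semi_sigma_additive kjoint.
Proof.
move=> F mF tF mUF.
have -> : kjoint (\bigcup_n F n) = (\sum_(0 <= n <oo) kjoint (F n))%E.
  rewrite /kjoint -integral_nneseries//; last first.
    by move=> n; apply: measurable_fun_xsection_finite_kernel; rewrite inE.
  apply: eq_integral => x _; rewrite xsection_bigcup.
  apply/esym/cvg_lim => //; apply: measure_semi_sigma_additive.
  - by move=> n; exact: measurable_xsection.
  - exact: trivIset_xsection.
  - by apply: bigcup_measurable => n _; exact: measurable_xsection.
by apply: is_cvg_nneseries => n _ _; exact: kjoint_ge0.
Qed.

HB.instance Definition _ := isMeasure.Build _ _ _ kjoint
  kjoint0 kjoint_ge0 kjoint_sigma_additive.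

Let kjoint_setT : kjoint setT = 1%E.
Proof.
rewrite /kjoint (eq_integral (cst 1%E)); last first.
  by move=> x _; rewrite xsectionE preimage_setT prob_kernel.
by rewrite integral_cst// mul1e; exact: probability_setT.
Qed.

HB.instance Definition _ :=
  Measure_isProbability.Build _ _ _ kjoint kjoint_setT.

Definition joint : probability (X * Y)%type R := kjoint.

End kernel_product.

Section mean_field_game.
Context (R : realType) (X : metricType R) (x0 : X)
  (m : nat) (A : set 'rV[R]_m) (a0 : A).

Local Notation BX := (borel x0).
Local Notation BA := (borel a0).
Local Notation PX := (probability BX R).

Definition policy : Type := R.-pker BX ~> BA.

Record system := System {
  cost : X -> A -> PX -> R;
  trans : X -> A -> PX -> PX }.

Definition distX : BX -> BX -> R := @mdist R X.

Definition distA (a b : A) : R :=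
  Num.sqrt (\sum_i (set_val a 0 i - set_val b 0 i) ^+ 2).

(* The metric of [X * A] underlying [W1] on probability measures on [X * A]:
   the sum of the metric of [X] and of the Euclidean metric of [A]. *)
Definition distXA (z w : (BX * BA)%type) : R := distX z.1 w.1 + distA z.2 w.2.

Definition W1X : PX -> PX -> \bar R := W1 distX.

Definition W1XA :
    probability (BX * BA)%type R -> probability (BX * BA)%type R -> \bar R :=
  W1 distXA.

Definition sys_continuous (S : system) : Prop :=
  forall (x_ : nat -> X) (a_ : nat -> A) (mu_ : nat -> weak_probability BX R)
         (x : X) (a : A) (mu : weak_probability BX R),
    x_ @ \oo --> x -> a_ @ \oo --> a -> mu_ @ \oo --> mu ->
    (cost S (x_ n) (a_ n) (mu_ n) @[n --> \oo] --> cost S x a mu) /\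
    ((trans S (x_ n) (a_ n) (mu_ n) : weak_probability BX R) @[n --> \oo]
       --> (trans S x a mu : weak_probability BX R)).

Definition sys_assumptions (beta : R) (S : system) : Prop :=
  sys_continuous S /\
  exists L K : R,
    [/\ forall x y a mu, `|cost S x a mu - cost S y a mu| <= L * mdist x y,
        forall x y a mu,
          (W1X (trans S x a mu) (trans S y a mu) <= (K * mdist x y)%:E)%E
      & beta * K < 1].

(* A horizon is [Some T], with times 0, ..., T - 1, or [None] for infinity. *)
Definition before (N : option nat) (t : nat) : bool :=
  if N is Some T then (t < T)%N else true.

Section process.
Context d (Omega : measurableType d).
Variables (x_ : nat -> Omega -> BX) (a_ : nat -> Omega -> BA).

(* The sigma-algebra generated by x_0, ..., x_(i-1) and a_0, ..., a_(j-1). *)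
Definition history (i j : nat) : set (set Omega) :=
  <<s [set E | (exists s B, [/\ (s < i)%N, measurable B & E = x_ s @^-1` B]) \/
               (exists s B, [/\ (s < j)%N, measurable B & E = a_ s @^-1` B])] >>.

(* The laws of a_t given (x_0, a_0, ..., x_t) and of x_(t+1) given
   (x_0, a_0, ..., x_t, a_t) are [pi t (x_t)] and
   [trans S (x_t) (a_t) (mu t)], by the defining property of conditional
   probabilities. *)
Record controlled (S : system) (mu0 : PX) (N : option nat) (mu : nat -> PX)
    (pi : nat -> policy) (P : probability Omega R) : Prop := Controlled {
  measurable_state : forall t, measurable_fun setT (x_ t);
  measurable_action : forall t, measurable_fun setT (a_ t);
  law_init : forall B, measurable B -> P (x_ 0%N @^-1` B) = mu0 B;
  law_action : forall t E B, before N t ->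
    history t.+1 t E -> measurable B ->
    P (E `&` a_ t @^-1` B) = (\int[P]_(w in E) pi t (x_ t w) B)%E;
  law_state : forall t E B, before N t.+1 ->
    history t.+1 t.+1 E -> measurable B ->
    P (E `&` x_ t.+1 @^-1` B) =
      (\int[P]_(w in E) trans S (x_ t w) (a_ t w) (mu t) B)%E }.

Definition expected_cost (S : system) (beta : R) (N : option nat)
    (mu : nat -> PX) (P : probability Omega R) : \bar R :=
  (\int[P]_w \sum_(0 <= t <oo | before N t)
     (beta ^+ t * cost S (x_ t w) (a_ t w) (mu t))%:E)%E.

End process.

Section equilibrium.
Variables (S : system) (beta : R).

(* [v] is the expected discounted cost of the Markov policy [pi] against the
   measure flow [mu].  It is computed on any probability space carrying the
   controlled process; its law, hence [v], is determined by the data, and it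
   exists by the Ionescu-Tulcea theorem. *)
Definition policy_cost (mu0 : PX) (N : option nat) (mu : nat -> PX)
    (pi : nat -> policy) (v : \bar R) : Prop :=
  exists d (Omega : measurableType d) (P : probability Omega R)
      (x_ : nat -> Omega -> BX) (a_ : nat -> Omega -> BA),
    controlled x_ a_ S mu0 N mu pi P /\
    v = expected_cost x_ a_ S beta N mu P.

Definition optimal (mu0 : PX) (N : option nat) (mu : nat -> PX)
    (pi : nat -> policy) : Prop :=
  exists2 v, policy_cost mu0 N mu pi v &
    forall pi' v', policy_cost mu0 N mu pi' v' -> (v <= v')%E.

(* Equalities of measures are equalities on measurable sets. *)
Definition consistent (N : option nat) (mu : nat -> PX)
    (pi : nat -> policy) : Prop :=
  forall t, before N t.+1 -> forall B, measurable B ->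
    mu t.+1 B = (\int[mu t]_x \int[pi t x]_a trans S x a (mu t) B)%E.

Definition mfe (mu0 : PX) (N : option nat) (pi : nat -> policy)
    (mu : nat -> PX) : Prop :=
  [/\ forall B, measurable B -> mu 0%N B = mu0 B,
      optimal mu0 N mu pi & consistent N mu pi].

Definition mfe_finite (mu0 : PX) (T : nat) := mfe mu0 (Some T).

Definition mfe_nonstationary (mu0 : PX) := mfe mu0 None.

Definition mfe_stationary (pi : policy) (mu : PX) : Prop :=
  mfe_nonstationary mu (fun=> pi) (fun=> mu).

Definition asymp_discount_optimal (mu0 : PX) (pi : nat -> policy)
    (mu : nat -> PX) : Prop :=
  mfe_nonstationary mu0 pi mu /\
  exists pi' mu', mfe_stationary pi' mu' /\
    W1XA (joint (pi t) (mu t)) (joint pi' mu') @[t --> \oo] --> 0%E.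

End equilibrium.

(* The flow (u_0, ..., u_(T-1)) continued by its last value. *)
Definition extend_flow {U : Type} (T : nat) (u : nat -> U) : nat -> U :=
  fun t => if (t < T)%N then u t else u T.-1.

(* The flow of joint laws, in the countable product of the spaces of
   probability measures on [X * A] with their weak topologies. *)
Definition joint_flow (pi : nat -> policy) (mu : nat -> PX) :
    {ptws nat -> weak_probability (BX * BA)%type R} :=
  fun t => joint (pi t) (mu t).

End mean_field_game.

(* Main.v *)
Require Import Defs.
From HB Require Import structures.
From mathcomp Require Import all_boot all_order all_algebra.
From mathcomp Require Import all_classical all_reals all_analysis.
From mathcomp Require Import measurable_realfun ring lra.

Set Implicit Arguments.
Unset Strict Implicit.
Unset Printing Implicit Defensive.

Import Order.TTheory GRing.Theory Num.Theory.
Import numFieldNormedType.Exports.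

Local Open Scope classical_set_scope.
Local Open Scope ring_scope.

(* The joint laws of the T-horizon equilibria converge weakly for each fixed time,
   hence in W1, so the limit flows stay within eps of each other at each time;
   letting t tend to infinity gives W1 <= eps.  Both steps rest on one gluing
   inequality, W1 p r <= W1 p q + W1 q' r + small, valid when q and q' nearly
   agree on a fine partition of unity.

   For the stationary equilibria, limits in W1 are unique, so the given limit and
   the one provided by asymptotic discount optimality have the same joint law.
   A joint law determines mu, and determines pi mu-almost everywhere; since the
   states of the stationary process all have law mu, the same process is
   controlled by both policies, with the same cost. *)

(** * Mixtures of measures *)

(** The textbook gluing lemma disintegrates both couplings along a common middle marginal. A
    partition of unity subordinate to a finite net replaces the disintegration at the price of a
    small error, and it tolerates middle marginals that differ slightly when tested on finitely many
    continuous functions. With equal middle marginals it yields the triangle inequality; with a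
    trivial coupling on one side it compares W1 with weak convergence.

    In the stationary part the obstacle is that a system takes measures as bundled objects, while
    equalities of measures are known on measurable sets only. Continuity of the system bridges this:
    the weak topology does not separate such measures, so the constant sequence at one of them
    converges to the other.

    The factor 3 leaves room: the proof stops at W1 at most 2 eps, the second eps being slack for
    the limit in time. *)

Section mixture.
Local Open Scope ereal_scope.
Context d d' (Om : measurableType d) (T : measurableType d') (R : realType).
Variables (mu : {measure set Om -> \bar R}) (k : Om -> {measure set T -> \bar R}).
Hypothesis mk : forall U, measurable U -> measurable_fun [set: Om] (k ^~ U).

(* [mixture] carries its measurability proof so that its measure structure can
   be inferred. *)
Definition mixture of (forall U, measurable U -> measurable_fun [set: Om] (k ^~ U)) :=
  fun U => \int[mu]_w k w U.

Let mixture0 : mixture mk set0 = 0.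
Proof. by apply: integral0_eq => w _; rewrite measure0. Qed.

Let mixture_ge0 U : 0 <= mixture mk U.
Proof. exact: integral_ge0. Qed.

Let mixture_sigma_additive : semi_sigma_additive (mixture mk).
Proof.
move=> F mF tF mUF.
have -> : mixture mk (\bigcup_n F n) = \sum_(0 <= n <oo) mixture mk (F n).
  rewrite /mixture -integral_nneseries//; last by move=> n; exact: mk.
  by apply: eq_integral => w _; rewrite measure_semi_bigcup.
by apply: is_cvg_nneseries => n _ _; exact: mixture_ge0.
Qed.

HB.instance Definition _ := isMeasure.Build _ _ _ (mixture mk)
  mixture0 mixture_ge0 mixture_sigma_additive.

Variable nu : {measure set T -> \bar R}.
Hypothesis nuE : forall U, measurable U -> nu U = \int[mu]_w k w U.

Import HBNNSimple.

Let integral_mixture_nnsfun (f : {nnsfun T >-> R}) :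
  \int[nu]_z (f z)%:E = \int[mu]_w \int[k w]_z (f z)%:E.
Proof.
have sint (m : {measure set T -> \bar R}) : \int[m]_z (f z)%:E =
    \sum_(r \in range f) r%:E * m (f @^-1` [set r]).
  by rewrite integralT_nnsfun sintegralE.
have ge0 w r : 0 <= r%:E * k w (f @^-1` [set r]).
  by apply: (mulemu_ge0 (fun r => f @^-1` [set r])) => r0; exact: preimage_nnfun0.
rewrite sint; under [RHS]eq_integral do rewrite sint.
rewrite ge0_integral_fsum//; last by move=> r; apply: measurable_funeM; exact: mk.
apply: eq_fsbigr => r _; rewrite nuE//.
have [r0|r0] := leP 0%R r; first by rewrite ge0_integralZl//; exact: mk.
by rewrite !integral0_eq ?mule0// => w _; rewrite preimage_nnfun0// measure0// mule0.
Qed.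

(** Simple functions increase to [f], and monotone convergence is applied under [nu], under each
    [k w] and under [mu]. Any [nu] agreeing with the mixture on measurable sets is allowed, so both
    glued measures and [joint] qualify. *)
Lemma integral_mixture f : measurable_fun [set: T] f -> (forall z, 0 <= f z) ->
  \int[nu]_z f z = \int[mu]_w \int[k w]_z f z.
Proof.
move=> mf f0; pose f_ := nnsfun_approx measurableT mf.
have intlim (m : {measure set T -> \bar R}) :
    \int[m]_z (f_ n z)%:E @[n --> \oo] --> \int[m]_z f z.
  rewrite (_ : \int[m]_z f z = \int[m]_z limn (fun n => (f_ n z)%:E)).
    apply: cvg_monotone_convergence => //.
    - by move=> n; exact/measurable_EFinP.
    - by move=> n z _; rewrite lee_fin.
    - by move=> z _ a b ab; rewrite lee_fin; exact/lefP/nd_nnsfun_approx.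
  by apply: eq_integral => z _; apply/esym/cvg_lim => //; exact: cvg_nnsfun_approx.
rewrite -(cvg_lim _ (intlim nu))//; apply/cvg_lim => //.
under eq_fun do rewrite integral_mixture_nnsfun.
rewrite (_ : \int[mu]_w _ = \int[mu]_w limn (fun n => \int[k w]_z (f_ n z)%:E)).
  apply: cvg_monotone_convergence => //.
  - move=> n; apply: (measurable_fun_integral_kernel mk) => [z|].
      by rewrite lee_fin.
    exact/measurable_EFinP.
  - by move=> n w _; apply: integral_ge0 => z _; rewrite lee_fin.
  - move=> w _ a b ab; apply: ge0_le_integral => //.
    + by move=> z _; rewrite lee_fin.
    + exact/measurable_EFinP.
    + exact/measurable_EFinP.
    + by move=> z _; rewrite lee_fin; exact/lefP/nd_nnsfun_approx.
by apply: eq_integral => w _; apply/esym/cvg_lim.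
Qed.

End mixture.

(** The joint law is the mixture of the images of [pi x] under [y |-> (x, y)]. *)
Lemma integral_joint d d' (X : measurableType d) (Y : measurableType d')
    (R : realType) (pi : R.-pker X ~> Y) (mu : probability X R)
    (f : X * Y -> \bar R) :
  measurable_fun setT f -> (forall z, (0 <= f z)%E) ->
  (\int[joint pi mu]_z f z = \int[mu]_x \int[pi x]_y f (x, y))%E.
Proof.
move=> mf f0.
have pairE x U : pushforward (pi x) (pair x) U = pi x (xsection U x).
  by rewrite /pushforward xsectionE.
rewrite (@integral_mixture _ _ _ _ _ mu (fun x => pushforward (pi x) (pair x)))//.
- by apply: eq_integral => x _; rewrite ge0_integral_pushforward.
- move=> U mU; apply: (eq_measurable_fun (fun x => pi x (xsection U x))) => [x _|].
    exact/esym/pairE.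
  by apply: measurable_fun_xsection_finite_kernel; rewrite inE.
- by move=> U mU; apply: eq_integral => x _; exact/esym/pairE.
Qed.

(** * Gluing couplings *)

Section coupling.
Local Open Scope ereal_scope.
Context d (Z : measurableType d) (R : realType) (mu nu : probability Z R)
  (g : probability (Z * Z)%type R) (gP : coupling mu nu g).

Lemma integral_coupling_fst f : measurable_fun [set: Z] f ->
  (forall z, 0 <= f z) -> \int[g]_z f z.1 = \int[mu]_x f x.
Proof.
move=> mf f0; transitivity (\int[pushforward g fst]_x f x).
  by rewrite ge0_integral_pushforward.
apply: eq_measure_integral => B mB _.
apply: etrans (gP mB).1; rewrite /pushforward; congr (g _).
by apply/seteqP; split => -[x y] //= [].
Qed.

Lemma integral_coupling_snd f : measurable_fun [set: Z] f ->
  (forall z, 0 <= f z) -> \int[g]_z f z.2 = \int[nu]_x f x.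
Proof.
move=> mf f0; transitivity (\int[pushforward g snd]_x f x).
  by rewrite ge0_integral_pushforward.
apply: eq_measure_integral => B mB _.
apply: etrans (gP mB).2; rewrite /pushforward; congr (g _).
by apply/seteqP; split => -[x y] //= [].
Qed.

End coupling.

(* [q] and [q'] are compared through a partition of unity [phi]; [w] redistributes
   its masses [a] under [q] and [b] under [q'], so that the density
   [W y y' = \sum_i \sum_j w i j * phi i y * phi j y'] on [g1 \x g2], pushed
   forward to the outer coordinates, couples [p] and [r].  No disintegration is
   needed. *)
Section gluing.
Local Open Scope ereal_scope.
Context d (Z : measurableType d) (R : realType) (dist : Z -> Z -> R).
Hypothesis dist_ge0 : forall x y, (0 <= dist x y)%R.
Hypothesis dist_tri : forall x y z, (dist x z <= dist x y + dist y z)%R.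
Hypothesis mdist : measurable_fun [set: Z * Z] (fun z => dist z.1 z.2).
Variables (p q q' r : probability Z R) (g1 g2 : probability (Z * Z)%type R).
Hypotheses (g1P : coupling p q g1) (g2P : coupling q' r g2).
Variables (I : finType) (phi : I -> Z -> R) (a b : I -> R) (w e : I -> I -> R).
Hypothesis mphi : forall i, measurable_fun [set: Z] (phi i).
Hypothesis phi_ge0 : forall i x, (0 <= phi i x)%R.
Hypothesis phi_sum : forall x, (\sum_i phi i x = 1)%R.
Hypothesis int_q : forall i, \int[q]_x (phi i x)%:E = (a i)%:E.
Hypothesis int_q' : forall i, \int[q']_x (phi i x)%:E = (b i)%:E.
Hypothesis w_ge0 : forall i j, (0 <= w i j)%R.
Hypothesis w_row : forall i, (\sum_j w i j * b j = 1)%R.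
Hypothesis w_col : forall j, (\sum_i w i j * a i = 1)%R.
Hypothesis e_ge0 : forall i j, (0 <= e i j)%R.
Hypothesis dist_e : forall i j x y,
  (0 < phi i x)%R -> (0 < phi j y)%R -> (dist x y <= e i j)%R.

Let P := g1 \x g2.
Let W (y y' : Z) : R := (\sum_i \sum_j w i j * phi i y * phi j y')%R.

Let W_ge0 y y' : (0 <= W y y')%R.
Proof. by do 2!(apply: sumr_ge0 => ? _); rewrite !mulr_ge0. Qed.

Let mW d' (T : measurableType d') (f g : T -> Z) :
  measurable_fun [set: T] f -> measurable_fun [set: T] g ->
  measurable_fun [set: T] (fun t => W (f t) (g t)).
Proof.
move=> mf mg; do 2!(apply: measurable_sum => ?).
apply: measurable_funM; last exact: measurableT_comp.
by apply: measurable_funM => //; exact: measurableT_comp.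
Qed.

(** By [w_row] the sum over [j] collapses, and what remains is the partition of unity at [y]. This
    normalisation is what preserves the outer marginal [p]; [int_W1] does the same for [r]. *)
Let int_W2 y : \int[q']_x (W y x)%:E = 1.
Proof.
have mterm i j : measurable_fun [set: Z] (fun x => (w i j * phi i y * phi j x)%R).
  by apply: measurable_funM.
under eq_integral do rewrite /W -sumEFin.
rewrite ge0_integral_sum//; last 2 first.
- by move=> i; apply/measurable_EFinP; apply: measurable_sum.
- by move=> i x _; rewrite lee_fin; apply: sumr_ge0 => j _; rewrite !mulr_ge0.
under eq_bigr => i _.
  under eq_integral do rewrite -sumEFin.
  rewrite ge0_integral_sum//; last 2 first.
  - by move=> j; apply/measurable_EFinP.
  - by move=> j x _; rewrite lee_fin !mulr_ge0.
  under eq_bigr => j _.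
    under eq_integral do rewrite EFinM.
    rewrite ge0_integralZl//; last 3 first.
    - exact/measurable_EFinP.
    - by move=> x _; rewrite lee_fin.
    - by rewrite lee_fin mulr_ge0.
    rewrite int_q' -EFinM mulrAC [(_ * phi i y)%R]mulrC.
    over.
  rewrite sumEFin -mulr_sumr w_row mulr1.
  over.
by rewrite sumEFin phi_sum.
Qed.

Let int_W1 y : \int[q]_x (W x y)%:E = 1.
Proof.
have mterm i j : measurable_fun [set: Z] (fun x => (w i j * phi i x * phi j y)%R).
  by apply: measurable_funM => //; apply: measurable_funM.
under eq_integral do rewrite /W exchange_big -sumEFin.
rewrite ge0_integral_sum//; last 2 first.
- by move=> i; apply/measurable_EFinP; apply: measurable_sum.
- by move=> i x _; rewrite lee_fin; apply: sumr_ge0 => j _; rewrite !mulr_ge0.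
under eq_bigr => j _.
  under eq_integral do rewrite -sumEFin.
  rewrite ge0_integral_sum//; last 2 first.
  - by move=> i; apply/measurable_EFinP.
  - by move=> i x _; rewrite lee_fin !mulr_ge0.
  under eq_bigr => i _.
    under eq_integral do rewrite mulrAC EFinM.
    rewrite ge0_integralZl//; last 3 first.
    - exact/measurable_EFinP.
    - by move=> x _; rewrite lee_fin.
    - by rewrite lee_fin mulr_ge0.
    rewrite int_q -EFinM mulrAC [(_ * phi j y)%R]mulrC.
    over.
  rewrite sumEFin -mulr_sumr w_col mulr1.
  over.
by rewrite sumEFin phi_sum.
Qed.

Let my : measurable_fun [set: (Z * Z) * (Z * Z)] (fun t => t.1.2).
Proof. exact: measurableT_comp measurable_snd measurable_fst. Qed.
Let my' : measurable_fun [set: (Z * Z) * (Z * Z)] (fun t => t.2.1).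
Proof. exact: measurableT_comp measurable_fst measurable_snd. Qed.

(** [F] does not see the second pair, over which the density [W] integrates to one. *)
Let int_P1 (F : Z * Z -> \bar R) : measurable_fun [set: Z * Z] F ->
  (forall z, 0 <= F z) ->
  \int[P]_t ((W t.1.2 t.2.1)%:E * F t.1) = \int[g1]_z F z.
Proof.
move=> mF F0; rewrite /P fubini_tonelli1; last 2 first.
- apply: emeasurable_funM; last exact: measurableT_comp.
  by apply/measurable_EFinP; exact: mW.
- by move=> t; rewrite mule_ge0// lee_fin.
apply: eq_integral => z _; rewrite /fubini_F/=.
under eq_integral do rewrite muleC.
rewrite ge0_integralZl//; last 2 first.
- by apply/measurable_EFinP; apply: mW.
- by move=> x _; rewrite lee_fin.
rewrite (integral_coupling_fst g2P (f := fun x => (W z.2 x)%:E)) ?int_W2 ?mule1//.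
- by apply/measurable_EFinP; apply: mW.
- by move=> x; rewrite lee_fin.
Qed.

Let int_P2 (F : Z * Z -> \bar R) : measurable_fun [set: Z * Z] F ->
  (forall z, 0 <= F z) ->
  \int[P]_t ((W t.1.2 t.2.1)%:E * F t.2) = \int[g2]_z F z.
Proof.
move=> mF F0; rewrite /P fubini_tonelli2; last 2 first.
- apply: emeasurable_funM; last exact: measurableT_comp.
  by apply/measurable_EFinP; exact: mW.
- by move=> t; rewrite mule_ge0// lee_fin.
apply: eq_integral => z _; rewrite /fubini_G/=.
under eq_integral do rewrite muleC.
rewrite ge0_integralZl//; last 2 first.
- by apply/measurable_EFinP; apply: mW.
- by move=> x _; rewrite lee_fin.
rewrite (integral_coupling_snd g1P (f := fun x => (W x z.1)%:E)) ?int_W1 ?mule1//.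
- by apply/measurable_EFinP; apply: mW.
- by move=> x; rewrite lee_fin.
Qed.

Let W_nng (t : (Z * Z) * (Z * Z)) : {nonneg R} := NngNum (W_ge0 t.1.2 t.2.1).

(** The quadruple [((x, y), (y', z))] sends mass [W y y'] to the single point [(x, z)]; mixing over
    [P] gives the image of the weighted product. *)
Let glue (t : (Z * Z) * (Z * Z)) : {measure set (Z * Z) -> \bar R} :=
  mscale (W_nng t) \d_(t.1.1, t.2.2).

Let glueE t (F : Z * Z -> \bar R) : measurable_fun [set: Z * Z] F ->
  (forall z, 0 <= F z) ->
  \int[glue t]_z F z = (W t.1.2 t.2.1)%:E * F (t.1.1, t.2.2).
Proof.
by move=> mF F0; rewrite ge0_integral_mscale// integral_dirac// diracT mul1e.
Qed.

Let mends : measurable_fun [set: (Z * Z) * (Z * Z)] (fun t => (t.1.1, t.2.2)).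
Proof.
apply: measurable_fun_pair.
- exact: measurableT_comp measurable_fst measurable_fst.
- exact: measurableT_comp measurable_snd measurable_snd.
Qed.

Let mglue U : measurable U -> measurable_fun setT (glue ^~ U).
Proof.
move=> mU; apply: emeasurable_funM.
  by apply/measurable_EFinP; exact: mW.
by apply/measurable_EFinP; apply: measurableT_comp mends; exact: measurable_indic.
Qed.

Let glued := mixture P mglue.

Let gluedE U : measurable U ->
  glued U = \int[P]_t ((W t.1.2 t.2.1)%:E * (\1_U (t.1.1, t.2.2))%:E).
Proof. by []. Qed.

Let glued_fst B : measurable B -> glued (B `*` setT) = p B.
Proof.
move=> mB; rewrite gluedE; last exact: measurableX.
under eq_integral => t _.
  rewrite (_ : \1_(B `*` setT) _ = \1_B t.1.1 :> R); last first.
    by rewrite !indicE; congr (nat_of_bool _)%:R; apply/idP/idP; rewrite !inE //= => -[].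
  over.
rewrite (int_P1 (F := fun z => (\1_B z.1)%:E)); last 2 first.
- by apply/measurable_EFinP; apply: measurableT_comp => //; exact: measurable_fst.
- by move=> z; rewrite lee_fin.
rewrite (integral_coupling_fst g1P (f := fun z => (\1_B z)%:E)); last 2 first.
- exact/measurable_EFinP.
- by move=> z; rewrite lee_fin.
by rewrite integral_indic// setIT.
Qed.

Let glued_snd B : measurable B -> glued (setT `*` B) = r B.
Proof.
move=> mB; rewrite gluedE; last exact: measurableX.
under eq_integral => t _.
  rewrite (_ : \1_(setT `*` B) _ = \1_B t.2.2 :> R); last first.
    by rewrite !indicE; congr (nat_of_bool _)%:R; apply/idP/idP; rewrite !inE //= => -[].
  over.
rewrite (int_P2 (F := fun z => (\1_B z.2)%:E)); last 2 first.
- by apply/measurable_EFinP; apply: measurableT_comp => //; exact: measurable_snd.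
- by move=> z; rewrite lee_fin.
rewrite (integral_coupling_snd g2P (f := fun z => (\1_B z)%:E)); last 2 first.
- exact/measurable_EFinP.
- by move=> z; rewrite lee_fin.
by rewrite integral_indic// setIT.
Qed.

Let glued_setT : glued setT = 1.
Proof. by rewrite -setXTT glued_fst// probability_setT. Qed.

HB.instance Definition _ := Measure.on glued.
HB.instance Definition _ := Measure_isProbability.Build _ _ _ glued glued_setT.

(** Only the inner coordinates occur; they are independent under [P], with laws [q] and [q']. *)
Let int_cross : \int[P]_t
    (\sum_i \sum_j w i j * phi i t.1.2 * phi j t.2.1 * e i j)%:E =
  (\sum_i \sum_j w i j * a i * b j * e i j)%:E.
Proof.
have mphi1 i : measurable_fun [set: (Z * Z) * (Z * Z)] (fun t => phi i t.1.2).
  exact: measurableT_comp my.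
have mphi2 i : measurable_fun [set: (Z * Z) * (Z * Z)] (fun t => phi i t.2.1).
  exact: measurableT_comp my'.
have mterm i j : measurable_fun [set: (Z * Z) * (Z * Z)]
    (fun t => (w i j * phi i t.1.2 * phi j t.2.1 * e i j)%R).
  by apply: measurable_funM => //; apply: measurable_funM => //; exact: measurable_funM.
have term_ge0 i j (t : (Z * Z) * (Z * Z)) :
    (0 <= w i j * phi i t.1.2 * phi j t.2.1 * e i j)%R by rewrite !mulr_ge0.
under eq_integral do rewrite -sumEFin.
rewrite ge0_integral_sum//; last 2 first.
- by move=> i; apply/measurable_EFinP; apply: measurable_sum.
- by move=> i x _; rewrite lee_fin; apply: sumr_ge0.
rewrite -sumEFin; apply: eq_bigr => i _.
under eq_integral do rewrite -sumEFin.
rewrite ge0_integral_sum//; last 2 first.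
- by move=> j; apply/measurable_EFinP.
- by move=> j x _; rewrite lee_fin.
rewrite -sumEFin; apply: eq_bigr => j _.
under eq_integral => t _.
  rewrite (_ : (w i j * _ * _ * _ = (w i j * e i j) *
    (phi i t.1.2 * phi j t.2.1))%R); last by ring.
  rewrite EFinM; over.
rewrite ge0_integralZl//; last 3 first.
- by apply/measurable_EFinP; exact: measurable_funM.
- by move=> x _; rewrite lee_fin mulr_ge0.
- by rewrite lee_fin mulr_ge0.
rewrite fubini_tonelli1; last 2 first.
- by apply/measurable_EFinP; exact: measurable_funM.
- by move=> x; rewrite lee_fin mulr_ge0.
rewrite (eq_integral (fun z : Z * Z => (b j)%:E * (phi i z.2)%:E)); last first.
  move=> z _; rewrite /fubini_F/=; under eq_integral do rewrite EFinM.
  rewrite ge0_integralZl//; last 3 first.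
  - by apply/measurable_EFinP; exact: measurableT_comp.
  - by move=> x _; rewrite lee_fin.
  - by rewrite lee_fin.
  rewrite (integral_coupling_fst g2P (f := fun x => (phi j x)%:E)); last 2 first.
  - exact/measurable_EFinP.
  - by move=> x; rewrite lee_fin.
  by rewrite int_q' muleC.
have b_ge0 : (0 <= b j)%R.
  by rewrite -lee_fin -int_q'; apply: integral_ge0 => x _; rewrite lee_fin.
rewrite ge0_integralZl//; last 2 first.
- by apply/measurable_EFinP; exact: measurableT_comp.
- by move=> x _; rewrite lee_fin.
rewrite (integral_coupling_snd g1P (f := fun x => (phi i x)%:E)) ?int_q; last 2 first.
- exact/measurable_EFinP.
- by move=> x; rewrite lee_fin.
by rewrite -!EFinM; congr (_%:E); ring.
Qed.

(** The path from [x] to [z] through [y] and [y'] is integrated against [W]: its outer legs cost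
    what [g1] and [g2] cost, and its middle leg is bounded by [e i j] on each piece. *)
Lemma W1_gluing : W1 dist p r <= \int[g1]_z (dist z.1 z.2)%:E +
  \int[g2]_z (dist z.1 z.2)%:E +
  (\sum_i \sum_j w i j * a i * b j * e i j)%:E.
Proof.
apply: (@le_trans _ _ (\int[glued]_z (dist z.1 z.2)%:E)).
  apply: ereal_inf_lbound; exists (glued : probability _ R) => //.
  by move=> B mB; split; [exact: glued_fst|exact: glued_snd].
have mdistE : measurable_fun [set: Z * Z] (fun z => (dist z.1 z.2)%:E).
  exact/measurable_EFinP.
have distE_ge0 (z : Z * Z) : 0 <= (dist z.1 z.2)%:E by rewrite lee_fin.
rewrite (integral_mixture (mu := P) mglue)//.
under eq_integral do rewrite glueE//=.
have mWE : measurable_fun [set: (Z * Z) * (Z * Z)] (fun t => (W t.1.2 t.2.1)%:E).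
  by apply/measurable_EFinP; exact: mW.
have mcross : measurable_fun [set: (Z * Z) * (Z * Z)] (fun t =>
    (\sum_i \sum_j w i j * phi i t.1.2 * phi j t.2.1 * e i j)%:E).
  apply/measurable_EFinP; do 2!(apply: measurable_sum => ?).
  apply: measurable_funM => //; apply: measurable_funM; last exact: measurableT_comp.
  by apply: measurable_funM => //; exact: measurableT_comp.
have m1 : measurable_fun [set: (Z * Z) * (Z * Z)]
    (fun t => (W t.1.2 t.2.1)%:E * (dist t.1.1 t.1.2)%:E).
  by apply: emeasurable_funM => //; exact: (measurableT_comp mdistE measurable_fst).
have m2 : measurable_fun [set: (Z * Z) * (Z * Z)]
    (fun t => (W t.1.2 t.2.1)%:E * (dist t.2.1 t.2.2)%:E).
  by apply: emeasurable_funM => //; exact: (measurableT_comp mdistE measurable_snd).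
rewrite -(int_P1 mdistE)// -(int_P2 mdistE)// -int_cross -!ge0_integralD//; last 5 first.
- by move=> t _; rewrite adde_ge0// mule_ge0// lee_fin.
- exact: emeasurable_funD.
- by move=> t _; rewrite lee_fin; do 2!(apply: sumr_ge0 => ? _); rewrite !mulr_ge0.
- by move=> t _; rewrite mule_ge0// lee_fin.
- by move=> t _; rewrite mule_ge0// lee_fin.
apply: ge0_le_integral => //.
- by move=> t _; rewrite mule_ge0// lee_fin.
- apply: emeasurable_funM => //.
  exact: (measurableT_comp mdistE mends).
- by apply: emeasurable_funD => //; exact: emeasurable_funD.
move=> [[x y] [y' z]] _ /=; rewrite -!EFinM -!EFinD lee_fin.
rewrite !mulr_suml -!big_split; apply: ler_sum => i _ /=.
rewrite !mulr_suml -!big_split; apply: ler_sum => j _ /=.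
rewrite -!mulrDr.
(* A piece on which one bump vanishes contributes zero to both sides; on the others [dist_e]
   applies. *)
have [->|phi_i] := eqVneq (phi i y) 0%R; first by rewrite mulr0 !mul0r.
have [->|phi_j] := eqVneq (phi j y') 0%R; first by rewrite mulr0 !mul0r.
have /dist_e le_e : (0 < phi i y)%R by rewrite lt_neqAle eq_sym phi_i phi_ge0.
have /le_e {}le_e : (0 < phi j y')%R by rewrite lt_neqAle eq_sym phi_j phi_ge0.
rewrite ler_wpM2l ?mulr_ge0//.
have := dist_tri x y z; have := dist_tri y y' z; lra.
Qed.

End gluing.

(** The matrix [w i j * a i * b j] is a coupling of the finite laws [a] and [b] with little mass off
    the diagonal. Working with its density [w] avoids dividing by masses that may vanish; [k] keeps
    the denominators and the remainders positive. *)
Lemma gluing_weights (R : realFieldType) (I : finType) (a b : I -> R) (k : R) :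
  (forall i, 0 <= a i) -> (forall i, 0 <= b i) ->
  \sum_i a i = 1 -> \sum_i b i = 1 -> 0 < k ->
  exists w : I -> I -> R, [/\ forall i j, 0 <= w i j,
    forall i, \sum_j w i j * b j = 1, forall j, \sum_i w i j * a i = 1 &
    \sum_i \sum_(j | j != i) w i j * a i * b j <= \sum_i (`|a i - b i| + k)].
Proof.
move=> a0 b0 a1 b1 k0.
(* Mass [min (a i) (b i)], up to [k], stays at [i]; what remains, of total mass
   [rho], is spread as a product. *)
pose c i := (Num.max (a i) (b i) + k)^-1.
have M0 i : 0 < Num.max (a i) (b i) + k by rewrite ltr_wpDl// le_max a0.
have c0 i : 0 < c i by rewrite invr_gt0.
have cM i : c i * (Num.max (a i) (b i) + k) = 1 by rewrite mulVf// gt_eqF.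
have ca i : 0 < 1 - c i * a i.
  rewrite subr_gt0 -(cM i) ltr_pM2l// (le_lt_trans (y := Num.max (a i) (b i)))//.
    by rewrite le_max lexx.
  by rewrite ltrDl.
have cb i : 0 < 1 - c i * b i.
  rewrite subr_gt0 -(cM i) ltr_pM2l// (le_lt_trans (y := Num.max (a i) (b i)))//.
    by rewrite le_max lexx orbT.
  by rewrite ltrDl.
pose rho := \sum_i a i * (1 - c i * b i).
(* Both laws have total mass one and give up the same diagonal mass [c i * a i * b i], so their
   remainders have equal totals. *)
have rhoE : rho = \sum_j b j * (1 - c j * a j).
  rewrite /rho; under eq_bigr do rewrite mulrBr mulr1.
  under [RHS]eq_bigr do rewrite mulrBr mulr1.
  by rewrite !big_split/= a1 b1; congr (_ + _); apply: eq_bigr => i _; ring.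
(* If [rho] vanished, every [a i] would vanish, against [a1]. *)
have rho_gt0 : 0 < rho.
  rewrite lt_neqAle sumr_ge0 ?andbT; last by move=> i _; rewrite mulr_ge0// ltW.
  apply/eqP => /esym/eqP; rewrite psumr_eq0 => [/allP rho0|i _]; last first.
    by rewrite mulr_ge0// ltW.
  have /eqP := a1; rewrite big1 ?[_ == 1]eq_sym ?oner_eq0// => i _.
  have := rho0 i (mem_index_enum i); rewrite mulf_eq0 => /orP[/eqP//|].
  by rewrite gt_eqF.
have rho_neq0 : rho != 0 by rewrite gt_eqF.
pose w i j := (i == j)%:R * c i + (1 - c i * b i) * (1 - c j * a j) / rho.
exists w; split.
- move=> i j; rewrite addr_ge0// ?mulr_ge0 ?invr_ge0// ltW//.
- move=> i; rewrite /w; under eq_bigr do rewrite mulrDl.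
  rewrite big_split/= (bigD1 i)//= eqxx mul1r big1 ?addr0; last first.
    by move=> j /negbTE; rewrite eq_sym => ->; rewrite !mul0r.
  under eq_bigr => j _.
    rewrite (_ : _ * b j = (1 - c i * b i) / rho * (b j * (1 - c j * a j))).
      over.
    by ring.
  by rewrite -mulr_sumr -rhoE divfK// addrC subrK.
- move=> j; rewrite /w; under eq_bigr do rewrite mulrDl.
  rewrite big_split/= (bigD1 j)//= eqxx mul1r big1 ?addr0; last first.
    by move=> i /negbTE ->; rewrite !mul0r.
  under eq_bigr => i _.
    rewrite (_ : _ * a i = (1 - c j * a j) / rho * (a i * (1 - c i * b i))).
      over.
    by ring.
  by rewrite -mulr_sumr divfK// addrC subrK.
(* Off the diagonal only the product part is left, and its total mass, diagonal included, is
   [rho]. *)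
apply: (@le_trans _ _ rho).
  rewrite (_ : rho = \sum_i \sum_j (1 - c i * b i) * (1 - c j * a j) / rho * a i * b j).
    apply: ler_sum => i _; rewrite [leRHS](bigD1 i)//= ler_wpDl//.
      by rewrite !mulr_ge0// ?invr_ge0// ltW.
    apply: ler_sum => j /negbTE; rewrite eq_sym /w => ->.
    by rewrite mul0r add0r.
  under eq_bigr => i _.
    under eq_bigr => j _.
      rewrite (_ : _ * a i * b j =
        (a i * (1 - c i * b i)) / rho * (b j * (1 - c j * a j))); last by ring.
      over.
    rewrite -mulr_sumr -rhoE divfK//; over.
  by [].
apply: ler_sum => i _.
(* The factor [c i * a i] is at most one, and the other factor is at most [|a i - b i| + k]. *)
have -> : a i * (1 - c i * b i) = c i * a i * (Num.max (a i) (b i) + k - b i).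
  by rewrite -{1}(cM i); ring.
have maxE : Num.max (a i) (b i) - b i <= `|a i - b i|.
  by rewrite maxEle; case: ifP => _; rewrite ?subrr ?normr_ge0 ?ler_norm.
have max_ge : b i <= Num.max (a i) (b i) by rewrite le_max lexx orbT.
apply: (@le_trans _ _ (Num.max (a i) (b i) + k - b i)); last by lra.
rewrite ler_piMl//; last by have := ca i; lra.
by lra.
Qed.

(** * Compact metrics compatible with a measurable topology *)

Lemma measurable_prop d (T : measurableType d) (P : Prop) :
  measurable [set _ : T | P].
Proof.
have [p|np] := pselect P; first by rewrite (_ : [set _ | _] = setT)//; apply/seteqP; split.
by rewrite (_ : [set _ | _] = set0)//; apply/seteqP; split.
Qed.

(** The topology and the sigma-algebra of [Z] are given beforehand, and the record says how [dist]
    fits them; this lets products with a product sigma-algebra and a sum of metrics be treated like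
    their factors. Compactness enters through finite nets. *)
Record compact_metric (R : realType) d (Z : topMeasurableType d)
    (dist : Z -> Z -> R) : Prop := CompactMetric {
  dist_ge0 : forall x y, 0 <= dist x y;
  distxx : forall x, dist x x = 0;
  dist_sym : forall x y, dist x y = dist y x;
  dist_tri : forall x y z, dist x z <= dist x y + dist y z;
  dist_continuous : forall x, continuous (dist x);
  dist_measurable : forall x, measurable_fun [set: Z] (dist x);
  dist_net : forall e, 0 < e ->
    exists l : seq Z, forall z, has (fun x => dist x z < e) l;
  dist_nbhs : forall x (U : set Z), nbhs x U ->
    exists2 e, 0 < e & forall y, dist x y < e -> U y }.

Section approximation.
Context (R : realType) d (Z : topMeasurableType d) (dist : Z -> Z -> R).
Hypothesis cm : compact_metric dist.

Lemma dist_cvg (u : nat -> Z) x :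
  dist x (u n) @[n --> \oo] --> (0 : R) -> u @ \oo --> x.
Proof.
move=> /cvgrPdist_lt du U /(dist_nbhs cm)[e e0 eU].
have := du e e0; apply: filterS => n.
by rewrite sub0r normrN ger0_norm ?(dist_ge0 cm)//; exact: eU.
Qed.

Let measurable_find (l : seq Z) e k :
  measurable [set z | find (fun x => dist x z < e) l = k].
Proof.
elim: l k => [|x l IHl] k /=; first exact: measurable_prop.
have mx : measurable [set z | dist x z < e].
  rewrite -[X in measurable X]setTI; apply: measurable_fun_ltr => //.
  exact: dist_measurable.
rewrite (_ : [set z | _] = ([set z | dist x z < e] `&` [set _ | 0%N = k]) `|`
    ([set z | (find (fun y => dist y z < e) l).+1 = k] `\` [set z | dist x z < e])).
  apply: measurableU; first by apply: measurableI => //; exact: measurable_prop.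
  apply: measurableD => //; case: k => [|k].
    by rewrite (_ : [set _ | _] = set0)//; apply/seteqP; split.
  rewrite (_ : [set z | _] = [set z | find (fun y => dist y z < e) l = k])//.
  by apply/seteqP; split => z /=; [case|move=> ->].
apply/seteqP; split => z /=.
  by case: ifPn => [xz|/negP xz] k_eq; [left|right].
by case=> [[->]|[+ /negP/negbTE ->]] //.
Qed.

(** [q n z] is the index of the first centre of a finite net within [1 / (n + 1)] of [z], and [s n]
    returns that centre. Rounding through a measurable index keeps every function of the rounded
    point measurable. *)
Lemma approximation : exists (q : nat -> Z -> nat) (s : nat -> nat -> Z),
  (forall n k, measurable (q n @^-1` [set k])) /\
  (forall z, s n (q n z) @[n --> \oo] --> z).
Proof.
have /choice[l lP] : forall n : nat, exists l : seq Z,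
    forall z, has (fun x => dist x z < n.+1%:R^-1) l.
  by move=> n; apply: (dist_net cm); rewrite invr_gt0.
exists (fun n z => find (fun x => dist x z < n.+1%:R^-1) (l n)).
exists (fun n => nth point (l n)); split=> [n k|z]; first exact: measurable_find.
apply: dist_cvg; apply: (squeeze_cvgr _ (cvg_cst 0) cvg_harmonic).
apply: nearW => n /=; rewrite (dist_ge0 cm)/= (dist_sym cm) ltW//.
by have := nth_find point (lP n z).
Qed.

End approximation.

(** Rounding both arguments makes [f] a pointwise limit of functions of two integer indices.
    Sequential continuity, the form of continuity assumed of a system, thus gives measurability for
    the product sigma-algebra. *)
Lemma measurable_sequential (R : realType) d1 d2 (Z1 : topMeasurableType d1)
    (Z2 : topMeasurableType d2) (dist1 : Z1 -> Z1 -> R) (dist2 : Z2 -> Z2 -> R)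
    (f : Z1 * Z2 -> R) :
  compact_metric dist1 -> compact_metric dist2 ->
  (forall (u1 : nat -> Z1) (u2 : nat -> Z2) z1 z2, u1 @ \oo --> z1 ->
    u2 @ \oo --> z2 -> f (u1 n, u2 n) @[n --> \oo] --> f (z1, z2)) ->
  measurable_fun [set: Z1 * Z2] f.
Proof.
move=> /approximation[q1 [s1 [mq1 s1P]]] /approximation[q2 [s2 [mq2 s2P]]] fP.
apply: (measurable_fun_cvg (h := fun n z =>
    f (s1 n (q1 n z.1), s2 n (q2 n z.2)))) => [n|[z1 z2] _]; last exact: fP.
move=> _ Y mY; rewrite setTI (_ : _ @^-1` _ = \bigcup_i \bigcup_j
    ([set _ | Y (f (s1 n i, s2 n j))] `&`
     ((q1 n @^-1` [set i]) `*` (q2 n @^-1` [set j])))).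
  do 2!(apply: bigcupT_measurable => ?).
  by apply: measurableI; [exact: measurable_prop|exact: measurableX].
apply/seteqP; split => [[z1 z2] /= Yf|[z1 z2] [i _ [j _ [/= + [-> ->]]]]] //.
by exists (q1 n z1) => //; exists (q2 n z2).
Qed.

Lemma measurable_dist (R : realType) d (Z : topMeasurableType d)
    (dist : Z -> Z -> R) :
  compact_metric dist -> measurable_fun [set: Z * Z] (fun z => dist z.1 z.2).
Proof.
move=> cm; apply: (measurable_sequential cm cm) => u1 u2 z1 z2 u1z u2z /=.
apply/cvgrPdist_le => e e0.
have dz (u : nat -> Z) z : u @ \oo --> z -> \forall n \near \oo, dist z (u n) < e / 2.
  move=> uz; have : dist z (u n) @[n --> \oo] --> dist z z.
    by apply: (cvg_comp _ _ uz); exact: (dist_continuous cm).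
  rewrite (distxx cm) => /cvgrPdist_lt/(_ (e / 2)).
  rewrite divr_gt0// => /(_ isT); apply: filterS => n.
  by rewrite sub0r normrN ger0_norm// (dist_ge0 cm).
near=> n.
have d1 : dist z1 (u1 n) < e / 2 by near: n; exact: dz.
have d2 : dist z2 (u2 n) < e / 2 by near: n; exact: dz.
have := dist_tri cm z1 (u1 n) z2; have := dist_tri cm (u1 n) (u2 n) z2.
have := dist_tri cm (u1 n) z1 (u2 n); have := dist_tri cm z1 z2 (u2 n).
rewrite (dist_sym cm (u1 n) z1) (dist_sym cm (u2 n) z2) ler_norml; lra.
Unshelve. all: by end_near.
Qed.

Lemma dist_bounded (R : realType) d (Z : topMeasurableType d)
    (dist : Z -> Z -> R) :
  compact_metric dist -> exists D, forall x y, dist x y <= D.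
Proof.
move=> cm; have [l lP] := dist_net cm (ltr01 : 0 < 1).
(* The double sum dominates every distance between centres; 2 pays for moving [x] and [y] to their
   centres. *)
exists (\sum_(x <- l) \sum_(y <- l) dist x y + 2) => x y.
have /hasP[x' x'l dx] := lP x; have /hasP[y' y'l dy] := lP y.
have sum_ge0 z : 0 <= \sum_(y <- l) dist z y.
  by apply: sumr_ge0 => ? _; exact: dist_ge0.
have : dist x' y' <= \sum_(x <- l) \sum_(y <- l) dist x y.
  rewrite (big_rem x')//= (big_rem y')//= -addrA ler_wpDr// addr_ge0//.
    by apply: sumr_ge0 => ? _; exact: dist_ge0.
  by apply: sumr_ge0 => ? _.
have := dist_tri cm x x' y; have := dist_tri cm x' y' y.
rewrite (dist_sym cm x x'); lra.
Qed.

(** * Wasserstein distance and weak convergence *)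

Lemma measurable_continuous (R : realType) d (Z : topMeasurableType d)
    (dist : Z -> Z -> R) (f : Z -> R) :
  compact_metric dist -> continuous f -> measurable_fun [set: Z] f.
Proof.
move=> cm cf; have mf : measurable_fun [set: Z * Z] (fun z => f z.1).
  apply: (measurable_sequential cm cm) => u u2 z z2 uz _.
  by apply: (cvg_comp _ _ uz); exact: cf.
by apply: (measurableT_comp mf (g := fun z => (z, z))); exact: measurable_fun_pair.
Qed.

Lemma partition_of_unity (R : realType) d (Z : topMeasurableType d)
    (dist : Z -> Z -> R) (e : R) : compact_metric dist -> 0 < e ->
  exists n (phi : 'I_n -> Z -> R),
    [/\ forall i, continuous (phi i), forall i, measurable_fun setT (phi i),
        forall i x, 0 <= phi i x, forall x, \sum_i phi i x = 1 &
        forall i x y, 0 < phi i x -> 0 < phi i y -> dist x y <= e].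
Proof.
move=> cm e0; have e2 : 0 < e / 2 by rewrite divr_gt0.
have [l lP] := dist_net cm e2.
pose t (i : 'I_(size l)) x := e / 2 - dist (nth point l i) x.
(* Twice the positive part of [t i]: a continuous bump, positive exactly on the ball of radius
   [e / 2] around the centre. *)
pose psi i x := `|t i x| + t i x.
have psi_gt0 i x : (0 < psi i x) = (dist (nth point l i) x < e / 2).
  rewrite /psi /t; apply/idP/idP; last by move=> ?; rewrite ger0_norm; lra.
  by rewrite !ltNge; apply: contra => ?; rewrite ler0_norm; lra.
have psi_ge0 i x : 0 <= psi i x.
  by rewrite /psi -lerBlDr sub0r -normrN ler_norm.
have ct i : continuous (t i).
  by move=> x; apply: cvgB; [exact: cvg_cst|exact: dist_continuous].
have cpsi i : continuous (psi i).
  by move=> x; apply: cvgD; [apply: cvg_norm; exact: ct|exact: ct].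
have sum_gt0 x : 0 < \sum_i psi i x.
  have := lP x; rewrite has_find => fl.
  rewrite (bigD1 (Ordinal fl))//= ltr_pwDl ?sumr_ge0// psi_gt0/=.
  exact: (@nth_find _ point _ _ (lP x)).
have cphi i : continuous (fun x => psi i x / \sum_j psi j x).
  move=> x; apply: cvgM; first exact: cpsi.
  apply: cvgV; first by rewrite gt_eqF.
  by apply: cvg_big => [|j _]; [exact: add_continuous|exact: cpsi].
exists (size l), (fun i x => psi i x / \sum_j psi j x); split => //.
- move=> i; exact: (measurable_continuous cm).
- by move=> i x; rewrite divr_ge0// ltW.
- by move=> x; rewrite -mulr_suml divff// gt_eqF.
move=> i x y; rewrite !pmulr_lgt0 ?invr_gt0// !psi_gt0 => dx dy.
by have := dist_tri cm x (nth point l i) y; rewrite (dist_sym cm x (nth _ _ _)); lra.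
Qed.

Lemma integral_partition_of_unity (R : realType) d (Z : measurableType d)
    (mu : probability Z R) n (phi : 'I_n -> Z -> R) :
  (forall i, measurable_fun setT (phi i)) -> (forall i x, 0 <= phi i x) ->
  (forall x, \sum_i phi i x = 1) ->
  (forall i, (\int[mu]_x (phi i x)%:E)%E = (\int[mu]_x phi i x)%:E) /\
  \sum_i \int[mu]_x phi i x = 1.
Proof.
move=> mphi phi0 phi1.
have int_ge0 i : (0 <= \int[mu]_x (phi i x)%:E)%E.
  by apply: integral_ge0 => x _; rewrite lee_fin.
have int1 : (\int[mu]_x (\sum_i phi i x)%:E = 1)%E.
  under eq_integral do rewrite phi1.
  by rewrite integral_cst// mul1e; exact: probability_setT.
have sum1 : (\sum_i \int[mu]_x (phi i x)%:E = 1)%E.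
  rewrite -int1; under [RHS]eq_integral do rewrite -sumEFin.
  rewrite ge0_integral_sum//; first by move=> i; exact/measurable_EFinP.
  by move=> i x _; rewrite lee_fin.
have intE i : (\int[mu]_x (phi i x)%:E)%E = (\int[mu]_x phi i x)%:E.
  rewrite /Rintegral fineK// ge0_fin_numE//.
  apply: (@le_lt_trans _ _ 1%E); last exact: ltry.
  by rewrite -sum1 (bigD1 i)//= leeDl// sume_ge0.
split=> //; apply: EFin_inj; rewrite -sum1 -sumEFin.
by apply: eq_bigr => i _; rewrite intE.
Qed.

Lemma W1_lt (R : realType) d (Z : measurableType d) (dist : Z -> Z -> R)
    (p q : probability Z R) (x : \bar R) : (W1 dist p q < x)%E ->
  exists2 g, coupling p q g & (\int[g]_z (dist z.1 z.2)%:E < x)%E.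
Proof. by move=> /ereal_inf_lt[_ [g gP <-] gx]; exists g. Qed.

(** The test functions and [k] depend on [dist] and [e] only, so weak convergence eventually meets
    the condition. Mass that stays in its piece moves by at most [e / 2]; the remaining mass is
    small and is charged the diameter bound. *)
Lemma W1_approx_triangle (R : realType) d (Z : topMeasurableType d)
    (dist : Z -> Z -> R) (e : R) : compact_metric dist -> 0 < e ->
  exists n (phi : 'I_n -> bounded_continuous Z R) (k : R), 0 < k /\
    forall (p q q' r : probability Z R) x y,
      (forall i, `|\int[q]_z sval (phi i) z - \int[q']_z sval (phi i) z| <= k) ->
      (W1 dist p q < x%:E)%E -> (W1 dist q' r < y%:E)%E ->
      (W1 dist p r <= (x + y + e)%:E)%E.
Proof.
move=> cm e0; have e2 : 0 < e / 2 by rewrite divr_gt0.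
have [n [phi [cphi mphi phi0 phi1 phie]]] := partition_of_unity cm e2.
have phi_le1 i x : `|phi i x| <= 1.
  by rewrite ger0_norm// -(phi1 x) (bigD1 i)//= lerDl sumr_ge0.
exists n, (fun i => exist _ (phi i) (conj (cphi i) (ex_intro _ 1 (phi_le1 i)))).
have [D distD] := dist_bounded cm.
pose D1 := `|D| + 1; have D10 : 0 < D1 by rewrite ltr_pwDr.
have distD1 x y : dist x y <= D1.
  by rewrite (le_trans (distD x y))// ler_wpDr// ler_norm.
(* Off-diagonal mass is at most [n * (2 * k)], which times [D1] must stay below [e / 2]; [n.+1] is a
   denominator that never vanishes. *)
pose k := e / 4 / D1 / n.+1%:R.
have k0 : 0 < k by rewrite !divr_gt0.
exists k; split=> // p q q' r x y /= qq' /W1_lt[g1 g1P g1x] /W1_lt[g2 g2P g2y].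
have [int_q sum_q] := integral_partition_of_unity q mphi phi0 phi1.
have [int_q' sum_q'] := integral_partition_of_unity q' mphi phi0 phi1.
set a := fun i => \int[q]_x phi i x in int_q sum_q.
set b := fun i => \int[q']_x phi i x in int_q' sum_q'.
have a0 i : 0 <= a i by apply: Rintegral_ge0.
have b0 i : 0 <= b i by apply: Rintegral_ge0.
have [w [w0 w_row w_col w_cross]] := gluing_weights a0 b0 sum_q sum_q' k0.
pose ee (i j : 'I_n) := if j == i then e / 2 else D1.
apply: le_trans (W1_gluing (w := w) (e := ee) _ _ _ g1P g2P mphi _ _ int_q int_q' _ _ _ _ _) _ => //.
- exact: dist_ge0.
- exact: dist_tri.
- exact: measurable_dist.
- by move=> i j; rewrite /ee; case: ifP => _; exact: ltW.
- move=> i j z z'; rewrite /ee; case: ifP => [/eqP -> |_ _ _]; last exact: distD1.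
  exact: phie.
rewrite 2!EFinD; apply: leeD; first by apply: leeD; exact: ltW.
rewrite lee_fin.
apply: (@le_trans _ _ (\sum_i ((e / 2) * a i) + \sum_i \sum_(j | j != i) w i j * a i * b j * D1)).
  rewrite -big_split; apply: ler_sum => i _ /=.
  rewrite (bigD1 i)//= {1}/ee eqxx; apply: lerD.
    rewrite mulrC ler_wpM2l ?(ltW e2)// -mulrA mulrCA ler_piMr ?a0//.
    by rewrite -(w_row i) (bigD1 i)//= lerDl sumr_ge0// => j _; rewrite mulr_ge0.
  by apply: ler_sum => j /negbTE; rewrite /ee => ->.
rewrite -mulr_sumr sum_q mulr1.
under eq_bigr do rewrite -mulr_suml.
rewrite -mulr_suml.
have : \sum_i (`|a i - b i| + k) <= n%:R * (2 * k).
  rewrite -[n in leRHS]card_ord -sum1_card natr_sum mulr_suml.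
  by apply: ler_sum => i _; rewrite mul1r; have := qq' i; rewrite -/(a i) -/(b i); lra.
move=> /(le_trans w_cross) cross_le.
have nk : n%:R * (2 * k) <= e / 2 / D1.
  rewrite /k (_ : _ * _ = e / 2 / D1 * (n%:R / n.+1%:R)); last by field; rewrite !gt_eqF.
  have e2D1 : 0 <= e / 2 / D1 by rewrite divr_ge0 ?ltW.
  by rewrite ler_piMr// ler_pdivrMr// mul1r ler_nat.
have := le_trans cross_le nk; rewrite ler_pdivlMr//; lra.
Qed.

Lemma probability_pushforward (R : realType) d d' (T : measurableType d)
    (T' : measurableType d') (f : T -> T') (mu : probability T R) :
  measurable_fun setT f ->
  exists nu : probability T' R, forall B, measurable B -> nu B = mu (f @^-1` B).
Proof.
move=> mf; pose f' : {mfun T >-> T'} := HB.pack f (isMeasurableFun.Build _ _ _ _ f mf).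
by exists (distribution mu f').
Qed.

Lemma W1_refl (R : realType) d (Z : topMeasurableType d) (dist : Z -> Z -> R)
    (p : probability Z R) : compact_metric dist -> (W1 dist p p <= 0)%E.
Proof.
move=> cm; have mdiag : measurable_fun [set: Z] (fun z => (z, z)).
  exact: measurable_fun_pair.
have [g gE] := probability_pushforward p mdiag.
apply: ereal_inf_lbound; exists g.
  move=> B mB; split.
    apply: etrans (gE _ (measurableX mB measurableT)) _; congr (p _).
    by apply/seteqP; split => z //= [].
  apply: etrans (gE _ (measurableX measurableT mB)) _; congr (p _).
  by apply/seteqP; split => z //= [].
rewrite (eq_measure_integral (pushforward p (fun z => (z, z)))); last first.
  by move=> B mB _; exact: gE.
rewrite ge0_integral_pushforward//; last 2 first.
- by apply/measurable_EFinP; exact: measurable_dist.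
- by move=> z _; rewrite lee_fin dist_ge0.
by rewrite preimage_setT integral0_eq// => z _ /=; rewrite (distxx cm).
Qed.

Lemma W1_sym (R : realType) d (Z : topMeasurableType d) (dist : Z -> Z -> R)
    (p q : probability Z R) : compact_metric dist -> W1 dist p q = W1 dist q p.
Proof.
move=> cm; have mswap : measurable_fun [set: Z * Z] (fun z => (z.2, z.1)).
  exact: measurable_fun_pair.
suff le_sym (p' q' : probability Z R) : (W1 dist p' q' <= W1 dist q' p')%E.
  by apply/eqP; rewrite eq_le !le_sym.
apply: le_ereal_inf_tmp => _ [g gP <-].
have [h hE] := probability_pushforward g mswap.
apply: ereal_inf_lbound; exists h.
  move=> B mB; split.
    apply: etrans (hE _ (measurableX mB measurableT)) _.
    apply: etrans (gP B mB).2; congr (g _).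
    by apply/seteqP; split => -[x y] //= [].
  apply: etrans (hE _ (measurableX measurableT mB)) _.
  apply: etrans (gP B mB).1; congr (g _).
  by apply/seteqP; split => -[x y] //= [].
rewrite (eq_measure_integral (pushforward g (fun z => (z.2, z.1)))); last first.
  by move=> B mB _; exact: hE.
rewrite ge0_integral_pushforward//; last 2 first.
- by apply/measurable_EFinP; exact: measurable_dist.
- by move=> z _; rewrite lee_fin dist_ge0.
by rewrite preimage_setT; apply: eq_integral => z _ /=; rewrite (dist_sym cm).
Qed.

Lemma ptws_cvg_eval (U : Type) (V : topologicalType) T (F : set_system T)
    (g : T -> {ptws U -> V}) (h : {ptws U -> V}) u :
  Filter F -> g @ F --> h -> g t u @[t --> F] --> h u.
Proof.
move=> FF /cvg_sup/(_ u) gh.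
apply: (cvg_comp (g : T -> initial_topology (fun f : U -> V => f u))
  (fun f => f u) gh).
exact: initial_continuous.
Qed.

Section wasserstein_topology.
Context (R : realType) d (Z : topMeasurableType d) (dist : Z -> Z -> R).
Hypothesis cm : compact_metric dist.
Implicit Types p q r : probability Z R.

(** Gluing with [q' = q]: the tests agree exactly and the error [e] is arbitrary. Strict bounds are
    used because they supply actual couplings. *)
Lemma W1_lt_triangle p q r x y : (W1 dist p q < x%:E)%E ->
  (W1 dist q r < y%:E)%E -> (W1 dist p r <= (x + y)%:E)%E.
Proof.
move=> pq qr; apply/lee_addgt0Pr => e e0.
have [n [phi [k [k0 glue]]]] := W1_approx_triangle cm e0.
by rewrite -EFinD; apply: glue pq qr => i; rewrite subrr normr0 ltW.
Qed.

Lemma weak_cvg_integral T (F : set_system T) (u : T -> weak_probability Z R)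
    (p : weak_probability Z R) (f : bounded_continuous Z R) :
  Filter F -> u @ F --> p ->
  \int[u t : probability Z R]_x sval f x @[t --> F] -->
    \int[p : probability Z R]_x sval f x.
Proof.
move=> FF up; apply: (@ptws_cvg_eval _ _ _ _
  (fun t f => \int[u t : probability Z R]_x sval f x)
  (fun f => \int[p : probability Z R]_x sval f x)).
apply: (cvg_comp u (fun mu : weak_probability Z R =>
  (fun f : bounded_continuous Z R => \int[mu : probability Z R]_x sval f x)
    : {ptws bounded_continuous Z R -> R}) up).
exact: initial_continuous.
Qed.

Lemma W1_weak_closed T (F : set_system T) (u v : T -> weak_probability Z R)
    (p q : weak_probability Z R) (e : R) : ProperFilter F ->
  u @ F --> p -> v @ F --> q ->
  (\forall t \near F, (W1 dist (u t) (v t) < e%:E)%E) ->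
  (W1 dist p q <= e%:E)%E.
Proof.
move=> FF up vq uv; apply/lee_addgt0Pr => c c0.
(* Two gluings, from [p] across to [u t] and from [v t] across to [q], cost a fifth each; so do the
   two trivial couplings at [p] and [q], and the passage from a weak to a strict bound in
   between. *)
have c5 : 0 < c / 5 by rewrite divr_gt0.
have [n [phi [k [k0 glue]]]] := W1_approx_triangle cm c5.
have near_phi (w : T -> weak_probability Z R) (m : weak_probability Z R) :
    w @ F --> m -> \forall t \near F, forall i, `|\int[m : probability Z R]_x sval (phi i) x -
      \int[w t : probability Z R]_x sval (phi i) x| <= k.
  move=> wm; apply: filter_forall => i.
  by have /cvgrPdist_le/(_ k k0) := weak_cvg_integral (f := phi i) FF wm.
have refl_lt (m : probability Z R) : (W1 dist m m < (c / 5)%:E)%E.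
  by apply: le_lt_trans (W1_refl m cm) _; rewrite lte_fin.
have [t [uvt upt vqt]] : exists t, [/\ (W1 dist (u t) (v t) < e%:E)%E,
    forall i, `|\int[p : probability Z R]_x sval (phi i) x -
      \int[u t : probability Z R]_x sval (phi i) x| <= k &
    forall i, `|\int[q : probability Z R]_x sval (phi i) x -
      \int[v t : probability Z R]_x sval (phi i) x| <= k].
  by apply: (@filter_ex _ F); near=> t; split; near: t => //; exact: near_phi.
have pv : (W1 dist p (v t) <= (c / 5 + e + c / 5)%:E)%E by exact: glue uvt.
have vq_le i : `|\int[v t : probability Z R]_x sval (phi i) x -
    \int[q : probability Z R]_x sval (phi i) x| <= k by rewrite distrC.
have pv_lt : (W1 dist p (v t) < (e + 3 * (c / 5))%:E)%E.
  by apply: le_lt_trans pv _; rewrite lte_fin; lra.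
apply: le_trans (glue _ _ _ _ _ _ vq_le pv_lt (refl_lt q)) _.
by rewrite -EFinD lee_fin; lra.
Unshelve. all: by end_near.
Qed.

(** Markov's inequality: a coupling of cost below [x] puts mass at most [x / e] on pairs at distance
    [e] or more, and every other pair starting in [A] ends in [B]. *)
Lemma W1_lt_measure_le p q (A B : set Z) (e x : R) : 0 < e ->
  measurable A -> measurable B ->
  (forall y z, A y -> dist y z < e -> B z) ->
  (W1 dist p q < x%:E)%E -> (p A <= q B + (x / e)%:E)%E.
Proof.
move=> e0 mA mB AB /W1_lt[g gP gx].
pose S := [set z : Z * Z | e <= dist z.1 z.2].
have mS : measurable S.
  rewrite -[X in measurable X]setTI; apply: measurable_fun_ler => //.
  exact: measurable_dist.
have gS : (g S <= (x / e)%:E)%E.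
  rewrite EFinM lee_pdivlMr//.
  apply: le_trans (ltW gx).
  rewrite muleC -integral_cst//.
  apply: (@le_trans _ _ (\int[g]_(z in S) (dist z.1 z.2)%:E)%E).
    apply: ge0_le_integral => //.
    - by move=> z _; rewrite lee_fin ltW.
    - by apply: measurable_funTS; apply/measurable_EFinP; exact: measurable_dist.
  apply: ge0_subset_integral => //.
  - by apply/measurable_EFinP; exact: measurable_dist.
  - by move=> z _; rewrite lee_fin dist_ge0.
rewrite -(gP A mA).1 -(gP B mB).2.
apply: le_trans (leeD2l _ gS).
apply: le_trans (measureU2 _ _ _) => //; last exact: measurableX.
apply: le_measure; rewrite ?inE; first exact: measurableX.
  by apply: measurableU => //; exact: measurableX.
move=> [y z] /= [Ay _]; have [|yz] := leP e (dist y z); first by right.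
by left; split => //; exact: AB yz.
Qed.

Lemma W1_eq0_measure_le p q (A : nat -> set Z) (B : set Z) :
  (forall n, measurable (A n)) -> nondecreasing_seq A -> \bigcup_n A n = B ->
  (forall n, exists2 e, 0 < e & forall y z, A n y -> dist y z < e -> B z) ->
  (forall x, 0 < x -> (W1 dist p q < x%:E)%E) -> (p B <= q B)%E.
Proof.
move=> mA ndA AB nbA pq0; have mB : measurable B by rewrite -AB; exact: bigcupT_measurable.
have pA n : (p (A n) <= q B)%E.
  have [e e0 eB] := nbA n; apply/lee_addgt0Pr => c c0.
  (* Closeness [c * e] turns the error [x / e] into [c]. *)
  have := W1_lt_measure_le e0 (mA n) mB eB (pq0 _ (mulr_gt0 c0 e0)).
  by rewrite mulfK// gt_eqF.
have := nondecreasing_cvg_mu (mu := p) mA; rewrite AB => /(_ mB ndA) pAB.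
by rewrite -(cvg_lim _ pAB)//; apply: lime_le; [exact: cvgP pAB|exact: nearW].
Qed.

End wasserstein_topology.

(** * Products and Borel spaces *)

Lemma compact_metric_prod (R : realType) d1 d2 (Z1 : topMeasurableType d1)
    (Z2 : topMeasurableType d2) (dist1 : Z1 -> Z1 -> R) (dist2 : Z2 -> Z2 -> R) :
  compact_metric dist1 -> compact_metric dist2 ->
  compact_metric (fun z w : Z1 * Z2 => dist1 z.1 w.1 + dist2 z.2 w.2).
Proof.
move=> cm1 cm2; split.
- by move=> z w; rewrite addr_ge0// (dist_ge0 cm1, dist_ge0 cm2).
- by move=> z; rewrite (distxx cm1) (distxx cm2) addr0.
- by move=> z w; rewrite (dist_sym cm1) (dist_sym cm2).
- move=> x y z; have := dist_tri cm1 x.1 y.1 z.1.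
  by have := dist_tri cm2 x.2 y.2 z.2; lra.
- move=> z w; apply: cvgD.
    apply: (cvg_comp _ _ cvg_fst); exact: (dist_continuous cm1).
  apply: (cvg_comp _ _ cvg_snd); exact: (dist_continuous cm2).
- move=> z; apply: measurable_funD.
    exact: measurableT_comp (dist_measurable cm1 z.1) measurable_fst.
  exact: measurableT_comp (dist_measurable cm2 z.2) measurable_snd.
- move=> e e0; have e2 : 0 < e / 2 by rewrite divr_gt0.
  have [l1 l1P] := dist_net cm1 e2; have [l2 l2P] := dist_net cm2 e2.
  exists [seq (x, y) | x <- l1, y <- l2] => -[z1 z2].
  have /hasP[x xl dx] := l1P z1; have /hasP[y yl dy] := l2P z2.
  apply/hasP; exists (x, y); first by apply/allpairsP; exists (x, y).
  by rewrite /=; lra.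
move=> [x y] U [[A B] /= [/(dist_nbhs cm1)[e1 e10 A1] /(dist_nbhs cm2)[e2 e20 B2]] AB].
exists (Num.min e1 e2); first by rewrite lt_min e10.
move=> [z w] /=; rewrite lt_min => /andP[lt1 lt2]; apply: AB; split => /=.
  by apply: A1; apply: le_lt_trans lt1; rewrite lerDl dist_ge0.
by apply: B2; apply: le_lt_trans lt2; rewrite lerDr dist_ge0.
Qed.

Section inner.
Context (R : realType) (T : topologicalType) (t0 : T)
  (dist : borel t0 -> borel t0 -> R).
Hypothesis cm : compact_metric dist.
Variable U : set T.

(** Points at distance at least [e] from the complement of [U], stated without an infimum so that an
    empty complement needs no separate case. *)
Definition inner (e : R) : set (borel t0) :=
  [set x | forall y, dist x y < e -> U y].

Lemma open_measurable_borel (V : set (borel t0)) : open V -> measurable V.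
Proof. exact: sub_sigma_algebra. Qed.

(** The complement is a union of open balls centred outside [U]. *)
Lemma measurable_inner e : measurable (inner e).
Proof.
rewrite -[inner e]setCK; apply: measurableC; apply: open_measurable_borel.
rewrite (_ : ~` _ = \bigcup_(y in ~` U) [set x | dist y x < e]).
  apply: bigcup_open => y _.
  have /continuousP : continuous (dist y) by exact: dist_continuous.
  by move=> /(_ _ (@open_lt R e)).
apply/seteqP; split => [x /existsNP[y /not_implyP[xy Uy]]|x [y Uy xy] xU].
  by exists y => //=; rewrite (dist_sym cm).
by apply: Uy; apply: xU; rewrite (dist_sym cm).
Qed.

Lemma inner_nondecreasing :
  nondecreasing_seq (fun n => inner n.+1%:R^-1).
Proof.
move=> m n mn; apply/subsetPset => x xU y xy; apply: xU; apply: lt_le_trans xy _.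
by rewrite lef_pV2 ?posrE// ler_nat.
Qed.

Lemma bigcup_inner : open U -> \bigcup_n inner n.+1%:R^-1 = U.
Proof.
move=> oU; apply/seteqP; split => [x [n _ /(_ x)]|x Ux].
  by apply; rewrite (distxx cm) invr_gt0.
have [e e0 eU] := dist_nbhs cm (open_nbhs_nbhs (conj oU Ux) : nbhs (x : borel t0) U).
have [n ne] : exists n : nat, n.+1%:R^-1 < e.
  exists (Num.truncn e^-1); rewrite invf_plt ?posrE// truncnS_gt//.
by exists n => // y xy; apply: eU; exact: lt_trans ne.
Qed.

End inner.

(** The sets whose strip over the other factor lies in the generated sigma-algebra form a
    sigma-algebra containing the open sets, and a measurable rectangle is the intersection of two
    strips. *)
Lemma measurable_prod_borel (T1 T2 : topologicalType) (t1 : T1) (t2 : T2) :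
  @measurable _ (borel t1 * borel t2)%type =
  <<s [set A `*` B | A in (@open T1) & B in (@open T2)] >>.
Proof.
pose G : set (set (borel t1 * borel t2)) := [set A `*` B | A in @open T1 & B in @open T2].
pose GT : measurableType _ := g_sigma_algebraType G.
rewrite -/G; apply/seteqP; split; last first.
  apply: smallest_sub; first exact: sigma_algebra_measurable.
  by move=> C [A oA [B oB <-]]; apply: measurableX; exact: open_measurable_borel.
rewrite measurable_prod_measurableType.
apply: smallest_sub; first exact: smallest_sigma_algebra.
move=> C [A mA [B mB <-]].
rewrite -[A]setIT -[B]setTI setXI; apply: (@measurableI _ GT).
  suff : @measurable _ (borel t1) `<=` [set A | @measurable _ GT (A `*` setT)] by apply.
  apply: smallest_sub => [|V oV]; last first.
    by apply: sub_sigma_algebra; exists V => //; exists setT => //; exact: openT.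
  split=> [|V mV|F mF] /=; first by rewrite set0X; exact: measurable0.
    rewrite (_ : _ `*` _ = ~` (V `*` setT)); first exact: measurableC.
    by apply/seteqP; split => -[x y] /=; tauto.
  by rewrite setX_bigcupl; exact: bigcupT_measurable.
suff : @measurable _ (borel t2) `<=` [set B | @measurable _ GT (setT `*` B)] by apply.
apply: smallest_sub => [|V oV]; last first.
  by apply: sub_sigma_algebra; exists setT; [exact: openT|exists V].
split=> [|V mV|F mF] /=; first by rewrite setX0; exact: measurable0.
  rewrite (_ : _ `*` _ = ~` (setT `*` V)); first exact: measurableC.
  by apply/seteqP; split => -[x y] /=; tauto.
by rewrite setX_bigcupr; exact: bigcupT_measurable.
Qed.

(** Open rectangles form a generating pi-system, and each is exhausted by inner rectangles at
    positive distance from its complement. *)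
Lemma W1_eq0_prod (R : realType) (T1 T2 : topologicalType) (t1 : T1) (t2 : T2)
    (dist1 : borel t1 -> borel t1 -> R) (dist2 : borel t2 -> borel t2 -> R)
    (P Q : probability (borel t1 * borel t2)%type R) :
  compact_metric dist1 -> compact_metric dist2 ->
  (forall x, 0 < x -> (W1 (fun z w : borel t1 * borel t2 =>
    (dist1 z.1 w.1 + dist2 z.2 w.2)%R) P Q < x%:E)%E) ->
  forall C, measurable C -> P C = Q C.
Proof.
move=> cm1 cm2 PQ0.
have cm := compact_metric_prod cm1 cm2.
pose G : set (set (borel t1 * borel t2)) := [set A `*` B | A in @open T1 & B in @open T2].
apply: (@measure_unique _ R (borel t1 * borel t2)%type G (fun=> setT)).
- exact: measurable_prod_borel.
- move=> _ _ [A1 oA1 [B1 oB1 <-]] [A2 oA2 [B2 oB2 <-]]; rewrite -setXI.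
  by exists (A1 `&` A2); [exact: openI|exists (B1 `&` B2) => //; exact: openI].
- by move=> _; exists setT; [exact: openT|exists setT; [exact: openT|rewrite setXTT]].
- by rewrite bigcup_const.
- move=> _ [A oA [B oB <-]].
  have le_AB (P' Q' : probability (borel t1 * borel t2)%type R) :
      (forall x, 0 < x -> (W1 (fun z w : borel t1 * borel t2 =>
        (dist1 z.1 w.1 + dist2 z.2 w.2)%R) P' Q' < x%:E)%E) ->
      (P' (A `*` B) <= Q' (A `*` B))%E.
    move=> PQ0'; apply: (W1_eq0_measure_le cm
      (A := fun n => inner dist1 A n.+1%:R^-1 `*` inner dist2 B n.+1%:R^-1)) => //.
    + by move=> n; apply: measurableX; exact: measurable_inner.
    + move=> m n mn; apply/subsetPset => -[x y] /= [xA yB].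
      by split; [have /subsetPset := inner_nondecreasing dist1 A mn; apply|
        have /subsetPset := inner_nondecreasing dist2 B mn; apply].
    + apply/seteqP; split => [[x y] [n _ [/= xA yB]]|[x y] /= []].
        by rewrite -(bigcup_inner cm1 oA) -(bigcup_inner cm2 oB); split; exists n.
      rewrite -{1}(bigcup_inner cm1 oA) -{1}(bigcup_inner cm2 oB).
      move=> [n _ xA] [k _ yB]; exists (maxn n k) => //=; split.
        by have /subsetPset := inner_nondecreasing dist1 A (leq_maxl n k); apply.
      by have /subsetPset := inner_nondecreasing dist2 B (leq_maxr n k); apply.
    + move=> n; exists n.+1%:R^-1; first by rewrite invr_gt0.
      move=> [x y] [x' y'] /= [xA yB] lt; split.
        by apply: xA; apply: le_lt_trans lt; rewrite lerDl dist_ge0.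
      by apply: yB; apply: le_lt_trans lt; rewrite lerDr dist_ge0.
  apply/eqP; rewrite eq_le !le_AB// => x x0.
  by rewrite W1_sym//; exact: PQ0.
- by move=> _; apply: (@le_lt_trans _ _ 1%E); [exact: probability_le1|exact: ltry].
Qed.

(** * Open sets as limits of bounded continuous functions *)

Section open_approximation.
Context (R : realType) d (Z : topMeasurableType d) (dist : Z -> Z -> R).
Hypothesis cm : compact_metric dist.
Variable U : set Z.

(* Junk value 0 when [U] is the whole space, treated separately below. *)
Let gap x : R := inf [set dist x y | y in ~` U].

Let gap_le x y : ~ U y -> gap x <= dist x y.
Proof.
move=> Uy; apply: ge_inf; last by exists y.
by exists 0 => _ [z _ <-]; exact: (dist_ge0 cm).
Qed.

Let gap_ge x e : ~` U !=set0 -> (forall y, ~ U y -> e <= dist x y) -> e <= gap x.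
Proof.
move=> [y Uy] ge_e; apply: lb_le_inf; first by exists (dist x y), y.
by move=> _ [z Uz <-]; exact: ge_e.
Qed.

Let gap_lip x y : ~` U !=set0 -> `|gap x - gap y| <= dist x y.
Proof.
move=> U0; suff lip a b : gap a <= gap b + dist a b.
  by have := lip x y; have := lip y x; rewrite (dist_sym cm y x) ler_norml; lra.
rewrite -lerBlDr; apply: gap_ge => // z Uz.
by have := gap_le a Uz; have := dist_tri cm a b z; lra.
Qed.

Let gap_continuous : ~` U !=set0 -> continuous gap.
Proof.
move=> U0 x; apply/cvgrPdist_lt => e e0.
have /cvgrPdist_lt/(_ e e0) : dist x y @[y --> x] --> dist x x.
  exact: (dist_continuous cm).
apply: filterS => y; rewrite (distxx cm) sub0r normrN ger0_norm ?(dist_ge0 cm)//.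
exact: le_lt_trans (gap_lip _ _ U0).
Qed.

(** The functions [min 1 (n * gap)] increase to the indicator of [U], and the same sequence serves
    every [mu]. *)
Lemma open_approximation : open U ->
  exists f : nat -> bounded_continuous Z R, forall mu : probability Z R,
    (\int[mu]_x sval (f n) x)%:E @[n --> \oo] --> mu U.
Proof.
move=> oU; have [U0|/set0P U0] := eqVneq (~` U) set0.
  have c1 : continuous (cst 1 : Z -> R) by move=> x; exact: cvg_cst.
  have b1 : exists M : R, forall x : Z, `|cst 1 x : R| <= M by exists 1 => x; rewrite normr1.
  exists (fun=> exist _ (cst 1) (conj c1 b1)) => mu /=.
  have -> : U = setT by rewrite -[U]setCK U0 setC0.
  have -> : ((\int[mu]_x cst 1 x)%:E = mu setT)%E.
    by rewrite Rintegral_cst// mul1r fineK// fin_num_measure.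
  exact: cvg_cst.
pose g (n : nat) x := Num.min 1 (n%:R * gap x).
have gap_ge0 x : 0 <= gap x by apply: gap_ge => // y _; exact: (dist_ge0 cm).
have g_ge0 n x : 0 <= g n x by rewrite le_min ler01 mulr_ge0.
have g_le1 n x : g n x <= 1 by rewrite ge_min lexx.
have cg n : continuous (g n).
  move=> x; apply: (@continuous_min R Z (cst 1) (fun x => n%:R * gap x)).
    exact: cvg_cst.
  by apply: cvgM; [exact: cvg_cst|exact: gap_continuous].
have bg n : exists M, forall x, `|g n x| <= M by exists 1 => x; rewrite ger0_norm.
exists (fun n => exist _ (g n) (conj (cg n) (bg n))) => mu /=.
have mg n : measurable_fun setT (g n) by exact: (measurable_continuous cm).
have gE n : ((\int[mu]_x g n x)%:E = \int[mu]_x (g n x)%:E)%E.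
  rewrite /Rintegral fineK// ge0_fin_numE; last first.
    by apply: integral_ge0 => x _; rewrite lee_fin.
  apply: (@le_lt_trans _ _ (\int[mu]_x (cst 1 x))%E).
    apply: ge0_le_integral => //.
    - by move=> x _; rewrite lee_fin.
    - exact/measurable_EFinP.
    - by move=> x _; rewrite lee_fin.
  by rewrite integral_cst// mul1e (le_lt_trans (probability_le1 _ _))// ltry.
under eq_fun do rewrite gE.
have gap_gt0 x : U x -> 0 < gap x.
  move=> Ux; have [e e0 eU] := dist_nbhs cm (open_nbhs_nbhs (conj oU Ux)).
  rewrite (lt_le_trans e0)//; apply: gap_ge => // y Uy.
  by rewrite leNgt; apply/negP => /eU.
have mU : measurable U.
  rewrite (_ : U = setT `&` [set x | 0 < gap x]).
    apply: measurable_fun_ltr => //; apply: (measurable_continuous cm).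
    exact: gap_continuous.
  rewrite setTI; apply/seteqP; split => x /=; first exact: gap_gt0.
  by move=> x0; apply: contrapT => /(gap_le x); rewrite (distxx cm); lra.
rewrite -[U]setIT -integral_indic//.
have -> : (\int[mu]_x (\1_U x)%:E = \int[mu]_x limn (fun n => (g n x)%:E))%E.
  apply: eq_integral => x _; apply/esym/cvg_lim => //; apply: cvg_EFin; first exact: nearW.
  have [Ux|Ux] := pselect (U x); rewrite /comp/= indicE ?(mem_set Ux) ?(memNset Ux).
    apply: cvg_near_cst; exists (Num.truncn (gap x)^-1).+1 => // n /= ngt.
    apply/min_idPl.
    rewrite -ler_pdivrMr ?gap_gt0// mul1r ltW// (lt_le_trans (truncnS_gt _))//.
    by rewrite ler_nat.
  have -> : (fun n => g n x) = cst 0.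
    apply/funext => n; rewrite /g (_ : gap x = 0) ?mulr0; first exact/min_idPr.
    by apply/eqP; rewrite eq_le gap_ge0 andbT -(distxx cm x) gap_le.
  exact: cvg_cst.
apply: cvg_monotone_convergence => //.
- by move=> n; exact/measurable_EFinP.
- by move=> n x _; rewrite lee_fin.
- move=> x _ m n mn; rewrite lee_fin /g le_min ge_min lexx/= ge_min.
  by rewrite ler_wpM2r ?orbT// ler_nat.
Qed.

End open_approximation.

(** The integrals determine the measure of every open set by [open_approximation], and open sets are
    a generating pi-system. *)
Lemma eq_weak_probability (R : realType) (T : topologicalType) (t0 : T)
    (dist : borel t0 -> borel t0 -> R) (mu nu : probability (borel t0) R) :
  compact_metric dist ->
  (forall f : bounded_continuous (borel t0) R,
    \int[mu]_x sval f x = \int[nu]_x sval f x) ->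
  forall B, measurable B -> mu B = nu B.
Proof.
move=> cm munu; apply: (@measure_unique _ R (borel t0) (@open T) (fun=> setT)).
- by [].
- by move=> A B oA oB; exact: openI.
- by move=> _; exact: openT.
- by rewrite bigcup_const.
- move=> U oU; have [f fU] := open_approximation cm oU.
  have := fU mu; under eq_fun do rewrite munu.
  by move=> /cvg_unique; apply => //; exact: fU.
- by move=> _; apply: (@le_lt_trans _ _ 1%E); [exact: probability_le1|exact: ltry].
Qed.

(** * The metrics of the state and action spaces *)

Lemma compact_finite_net (T : ptopologicalType) (K : set T) (V : T -> set T) :
  compact K -> (forall x, K x -> nbhs x (V x)) ->
  exists l : seq T, (forall x, x \in l -> K x) /\
    forall y, K y -> exists2 x, x \in l & V x y.
Proof.
rewrite compact_cover => cK KV.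
have [|y Ky|D DK KD] := cK T K (fun x => interior (V x)).
- by move=> x _; exact: open_interior.
- by exists y => //; exact: KV.
exists (finmap.enum_fset D); split => [x /DK|y /KD[x /= xD Vxy]]; first by rewrite inE.
by exists x => //; exact: interior_subset Vxy.
Qed.

Lemma continuous_measurable_borel (R : realType) (T : topologicalType) (t0 : T)
    (f : T -> R) : continuous f -> measurable_fun [set: borel t0] (f : borel t0 -> R).
Proof.
move=> /continuousP cf; apply: (measurability _ (RGenOInfty.measurableE R)).
move=> _ [_ [x ->] <-]; rewrite setTI; apply: sub_sigma_algebra; apply: cf.
exact: interval_open.
Qed.

Lemma compact_metric_distX (R : realType) (X : metricType R) (x0 : X) :
  compact [set: X] -> compact_metric (@distX R X x0).
Proof.
move=> cX; have cont (x : X) : continuous (mdist x).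
  move=> y; apply/cvgrPdist_lt => e e0.
  have : \forall z \near y, mdist y z < e.
    by have := nbhsx_ballx y e e0; rewrite ballEmdist.
  apply: filterS => z; apply: le_lt_trans.
  have := metric_triangle x y z; have := metric_triangle x z y.
  by rewrite (metric_sym z y) ler_norml; lra.
split.
- by move=> x y; exact: mdist_ge0.
- by move=> x; exact: mdistxx.
- by move=> x y; exact: metric_sym.
- by move=> x y z; exact: metric_triangle.
- exact: cont.
- by move=> x; apply: continuous_measurable_borel; exact: cont.
- move=> e e0; have [|x _|l [_ lP]] := @compact_finite_net (borel x0) setT
    (fun x => [set y : X | mdist (x : X) y < e]).
  + exact: cX.
  + by have := nbhsx_ballx (x : X) e e0; rewrite ballEmdist.
  exists l => y; have [x xl xy] := lP y I.
  by apply/hasP; exists x.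
- move=> x U /nbhs_ballP[e /= e0 eU]; exists e => // y xy; apply: eU.
  by rewrite ballEmdist.
Qed.

(** Minkowski's inequality; squaring reduces it to Cauchy-Schwarz. *)
Lemma sqrt_sum_sqr_triangle (R : rcfType) n (u v : 'I_n -> R) :
  Num.sqrt (\sum_i (u i + v i) ^+ 2) <=
  Num.sqrt (\sum_i u i ^+ 2) + Num.sqrt (\sum_i v i ^+ 2).
Proof.
have su : 0 <= \sum_i u i ^+ 2 by apply: sumr_ge0 => i _; exact: sqr_ge0.
have sv : 0 <= \sum_i v i ^+ 2 by apply: sumr_ge0 => i _; exact: sqr_ge0.
have CS : (\sum_i u i * v i) ^+ 2 <= (\sum_i u i ^+ 2) * (\sum_i v i ^+ 2).
  have : 0 <= \sum_i \sum_j (u i * v j - u j * v i) ^+ 2.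
    by do 2!(apply: sumr_ge0 => ? _); exact: sqr_ge0.
  (* Lagrange's identity, doubled because the sum runs over ordered pairs. *)
  have -> : \sum_i \sum_j (u i * v j - u j * v i) ^+ 2 =
      (\sum_i u i ^+ 2) * (\sum_i v i ^+ 2) * 2 - 2 * (\sum_i u i * v i) ^+ 2.
    pose a i j := u i ^+ 2 * v j ^+ 2; pose b i j := u i * v i * (u j * v j).
    have aE : \sum_i \sum_j a i j = (\sum_i u i ^+ 2) * (\sum_i v i ^+ 2).
      by rewrite mulr_suml; apply: eq_bigr => i _; rewrite mulr_sumr.
    have bE : \sum_i \sum_j b i j = (\sum_i u i * v i) ^+ 2.
      by rewrite expr2 mulr_suml; apply: eq_bigr => i _; rewrite mulr_sumr.
    rewrite -aE -bE mulr_natr mulr2n {2}[\sum_i \sum_j a i j]exchange_big/=.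
    rewrite mulr_natl mulr2n -!big_split -sumrB; apply: eq_bigr => i _.
    rewrite -!big_split -sumrB; apply: eq_bigr => j _.
    by rewrite /a /b /=; ring.
  by lra.
rewrite -(@ler_pXn2r _ 2)// ?nnegrE ?addr_ge0 ?sqrtr_ge0//.
rewrite sqr_sqrtr; last by apply: sumr_ge0 => i _; exact: sqr_ge0.
rewrite sqrrD !sqr_sqrtr// -sqrtrM//.
under eq_bigr do rewrite sqrrD.
rewrite !big_split/= -mulr2n lerD2r lerD2l ler_pMn2r//.
by rewrite (le_trans (ler_norm _))// -sqrtr_sqr ler_sqrt// mulr_ge0.
Qed.

Lemma compact_metric_distA (R : realType) m (A : set 'rV[R]_m) (a0 : A) :
  compact A -> @compact_metric R _ (borel a0) (@distA R m A).
Proof.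
move=> cA.
pose co (a : A) i := set_val a 0 i : R.
have sq_ge0 (a b : A) : 0 <= \sum_i (co a i - co b i) ^+ 2.
  by apply: sumr_ge0 => i _; exact: sqr_ge0.
have co_le (a b : A) i : `|co a i - co b i| <= distA a b.
  rewrite -sqrtr_sqr ler_sqrt ?sq_ge0// (bigD1 i)//= lerDl.
  by apply: sumr_ge0 => j _; exact: sqr_ge0.
have co_continuous i : continuous (co ^~ i).
  move=> a; apply: (cvg_comp (set_val : A -> 'rV[R]_m) (fun v => v 0 i)).
    exact: initial_continuous.
  exact: coord_continuous.
have cont (a : A) : continuous (distA a).
  have cs : continuous (fun b : A => \sum_i (co a i - co b i) ^+ 2).
    apply: continuous_big => [|i _ b]; first exact: add_continuous.
    have ci : co a i - co c i @[c --> b] --> co a i - co b i.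
      have FF : Filter (nbhs b) by exact: nbhs_filter.
      by apply: cvgB; [exact: cvg_cst|exact: co_continuous].
    exact: (cvgM ci ci).
  by move=> b; exact: (continuous_comp (cs b) (@sqrt_continuous R _)).
have ball_lt (a b : A) e : distA a b < e -> ball (set_val a) e (set_val b).
  move=> abe; split; first exact: le_lt_trans (sqrtr_ge0 _) abe.
  by move=> i j; rewrite ord1; exact: le_lt_trans (co_le a b j) abe.
split.
- by move=> a b; exact: sqrtr_ge0.
- by move=> a; rewrite /distA big1 ?sqrtr0// => i _; rewrite subrr expr0n.
- by move=> a b; rewrite /distA; congr Num.sqrt; apply: eq_bigr => i _; rewrite -sqrrN opprB.
- move=> a b c; apply: le_trans (sqrt_sum_sqr_triangle
    (fun i => co a i - co b i) (fun i => co b i - co c i)).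
  rewrite le_eqVlt; apply/orP; left; apply/eqP; congr Num.sqrt.
  by apply: eq_bigr => i _; congr (_ ^+ 2); rewrite /co; ring.
- exact: cont.
- by move=> a; apply: continuous_measurable_borel; exact: cont.
(* Balls of row vectors are coordinatewise: coordinates within [e'] give Euclidean distance at most
   [m * e'], which is below [e], also for [m = 0]. *)
- move=> e e0; pose e' := e / m.+1%:R; have e'0 : 0 < e' by rewrite divr_gt0.
  have [|l [lA lP]] := @compact_finite_net 'rV[R]_m A (fun v => ball v e') cA.
    by move=> v _; exact: nbhsx_ballx.
  have lA' : forall v, exists a : A, v \in l -> set_val a = v.
    move=> v; have [/lA Av|] := boolP (v \in l); last by exists a0.
    by exists (exist _ v (mem_set Av)).
  have /choice[f fP] := lA'.
  exists (map f l) => b; have [v vl vb] := lP (set_val b) (set_valP b).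
  apply/hasP; exists (f v); first exact: map_f.
  have dist_le : distA (f v) b <= \sum_(i < m) e'.
    rewrite -[leRHS]ger0_norm; last by apply: sumr_ge0 => _ _; exact: ltW.
    rewrite -sqrtr_sqr ler_sqrt ?sqr_ge0//.
    have -> : \sum_i (co (f v) i - co b i) ^+ 2 <= (\sum_(i < m) e') ^+ 2.
      apply: (@le_trans _ _ (\sum_(i < m) e' ^+ 2)).
        apply: ler_sum => i _; rewrite -real_normK ?num_real//.
        rewrite ler_pXn2r ?nnegrE ?normr_ge0 ?(ltW e'0)//; apply: ltW.
        by have := vb.2 0 i; rewrite /co fP.
      rewrite [leRHS]expr2 mulr_suml; apply: ler_sum => i _.
      rewrite expr2 ler_wpM2l ?(ltW e'0)// (bigD1 i)//= lerDl.
      by apply: sumr_ge0 => _ _; exact: ltW.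
    by [].
  apply: le_lt_trans dist_le _.
  rewrite sumr_const card_ord -[_ *+ _]mulr_natr /e' mulrAC ltr_pdivrMr//.
  by rewrite ltr_pM2l// ltr_nat.
move=> a U /nbhs_ballP[e /= e0 eU]; exists e => // b ab; apply: eU.
by rewrite -initial_ballE; exact: ball_lt.
Qed.

(** * Stationary equilibria *)

Lemma joint_setX d d' (X : measurableType d) (Y : measurableType d')
    (R : realType) (pi : R.-pker X ~> Y) (mu : probability X R) C D :
  measurable C -> measurable D ->
  joint pi mu (C `*` D) = (\int[mu]_(x in C) pi x D)%E.
Proof.
move=> mC mD; rewrite [LHS]/= /joint /kjoint [RHS]integral_mkcond.
apply: eq_integral => x _; rewrite patchE; case: ifPn => xC.
  by rewrite in_xsectionX.
by rewrite notin_xsectionX// measure0.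
Qed.

Lemma joint_setXT d d' (X : measurableType d) (Y : measurableType d')
    (R : realType) (pi : R.-pker X ~> Y) (mu : probability X R) C :
  measurable C -> joint pi mu (C `*` setT) = mu C.
Proof.
move=> mC; rewrite joint_setX// (eq_integral (cst 1%E)).
  by rewrite integral_cst// mul1e.
by move=> x _; rewrite prob_kernel.
Qed.

(** Rectangles with full second side recover the measure; the others give [pi ^~ B] and [pi' ^~ B]
    equal integrals over every measurable set. The exceptional null set may depend on [B]. *)
Lemma joint_inj d d' (X : measurableType d) (Y : measurableType d')
    (R : realType) (pi pi' : R.-pker X ~> Y) (mu mu' : probability X R) :
  (forall C, measurable C -> joint pi mu C = joint pi' mu' C) ->
  (forall B, measurable B -> mu B = mu' B) /\
  (forall B, measurable B -> ae_eq mu setT (pi ^~ B) (pi' ^~ B)).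
Proof.
move=> jE; have mumu' B : measurable B -> mu B = mu' B.
  by move=> mB; rewrite -(joint_setXT pi)// -(joint_setXT pi')// jE//; exact: measurableX.
split=> // B mB; have mpi (p : R.-pker X ~> Y) : measurable_fun setT (p ^~ B).
  exact: measurable_kernel.
apply: integral_ae_eq => //.
  apply: (@le_integrable _ _ _ mu _ measurableT _ (cst 1%E)) => //.
    move=> x _; rewrite /= normr1 gee0_abs//.
    by rewrite -(@prob_kernel _ _ _ _ _ pi x) le_measure ?inE.
  exact: finite_measure_integrable_cst.
move=> E _ mE; rewrite -joint_setX// jE; last exact: measurableX.
by rewrite joint_setX//; apply: eq_measure_integral => F mF _; exact/esym/mumu'.
Qed.

(** * Transfer of equilibria between pairs with the same joint law *)

Section game.
Context (R : realType) (X : metricType R) (x0 : X)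
  (m : nat) (A : set 'rV[R]_m) (a0 : A).
Hypotheses (compactX : compact [set: X]) (compactA : compact A).
Local Notation BX := (borel x0).
Local Notation BA := (borel a0).
Local Notation PX := (probability BX R).
Variable S : system x0 A.
Hypothesis Scont : sys_continuous S.

Let cmX := compact_metric_distX x0 compactX.
Let cmA := compact_metric_distA a0 compactA.

(** The weak topology is initial for the integrals, which take the same values at [mu] and [nu];
    hence every neighbourhood of [nu] contains [mu]. *)
Lemma cvg_eq_measure (mu nu : PX) : (forall B, measurable B -> mu B = nu B) ->
  (fun=> mu : weak_probability BX R) @ \oo --> (nu : weak_probability BX R).
Proof.
move=> munu U; rewrite nbhsE => -[W [[V oV VW] Wnu] WU].
exists 0%N => // n _ /=; apply: WU; rewrite -VW; move: Wnu; rewrite -VW /=.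
rewrite (_ : (fun f : bounded_continuous BX R => \int[nu]_x sval f x) =
  (fun f => \int[mu]_x sval f x))//.
apply/funext => f; congr fine; apply: eq_measure_integral => B mB _.
exact/esym/munu.
Qed.

(** Continuity along the constant sequence [mu], which converges to [nu]: the values at [mu]
    converge to those at [nu], and limits of costs and of integrals are unique. *)
Lemma sys_eq_measure (mu nu : PX) x a : (forall B, measurable B -> mu B = nu B) ->
  cost S x a mu = cost S x a nu /\
  forall B, measurable B -> trans S x a mu B = trans S x a nu B.
Proof.
move=> munu.
have [costE transE] := Scont (@cvg_cst _ x _ _ _) (@cvg_cst _ a _ _ _) (cvg_eq_measure munu).
split; first by apply: (cvg_unique _ _ costE) => //; exact: cvg_cst.
apply: (eq_weak_probability cmX) => f.
have intE : \int[trans S x a mu]_y sval f y @[_ --> \oo] -->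
    \int[trans S x a nu]_y sval f y by exact: weak_cvg_integral transE.
by apply: (cvg_unique _ _ intE) => //; exact: cvg_cst.
Qed.

(** Integrals of continuous functions against [trans] are sequentially continuous in the state and
    action; limits of them give open sets, and Dynkin's theorem the rest. *)
Lemma measurable_trans (mu : PX) B : measurable B ->
  measurable_fun [set: BX * BA] (fun z => trans S z.1 z.2 mu B).
Proof.
pose mt B := measurable_fun [set: BX * BA] (fun z => trans S z.1 z.2 mu B).
have : @measurable _ BX `<=` mt.
  apply: (@dynkin_induction _ BX (@open X) mt) => //.
  - by move=> U V; exact: openI.
  - rewrite /mt (_ : (fun _ => _) = cst 1%E)//.
    by apply/funext => z; exact: probability_setT.
  - move=> U oU; have [f fU] := open_approximation cmX oU.
    rewrite /mt; apply: (emeasurable_fun_cvg (fun n (z : BX * BA) =>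
        (\int[trans S z.1 z.2 mu]_x sval (f n) x)%:E)) => [n|z _]; last exact: fU.
    apply/measurable_EFinP; apply: (measurable_sequential cmX cmA) => u1 u2 x a u1x u2a.
    apply: weak_cvg_integral.
    by have [_] := Scont u1x u2a (@cvg_cst _ (mu : weak_probability BX R) _ _ _).
  - move=> U mU mtU; rewrite /mt.
    rewrite (_ : (fun _ => _) = (fun z => (1 - trans S z.1 z.2 mu U)%E)).
      exact: emeasurable_funB.
    by apply/funext => z; rewrite probability_setC.
  - move=> F mF tF mtF; rewrite /mt.
    rewrite (_ : (fun _ => _) = (fun z => (\sum_(0 <= k <oo) trans S z.1 z.2 mu (F k))%E)).
      by apply: ge0_emeasurable_sum => // k _; exact: mtF.
    by apply/funext => z; rewrite measure_semi_bigcup//; exact: bigcupT_measurable.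
exact.
Qed.

Section controlled.
Context d (Omega : measurableType d) (P : probability Omega R)
  (x_ : nat -> Omega -> BX) (a_ : nat -> Omega -> BA).

Lemma history_measurable i j E : (forall t, measurable_fun setT (x_ t)) ->
  (forall t, measurable_fun setT (a_ t)) -> history x_ a_ i j E -> measurable E.
Proof.
move=> mx ma; apply: smallest_sub; first exact: sigma_algebra_measurable.
move=> _ [[s [B [_ mB ->]]]|[s [B [_ mB ->]]]]; rewrite -[_ @^-1` _]setTI.
  exact: mx.
exact: ma.
Qed.

Lemma history_state i j s B : (s < i)%N -> measurable B ->
  history x_ a_ i j (x_ s @^-1` B).
Proof. by move=> si mB; apply: sub_sigma_algebra; left; exists s, B. Qed.

Lemma controlled_eq_measure (mu nu : PX) N pi :
  (forall B, measurable B -> mu B = nu B) ->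
  controlled x_ a_ S mu N (fun=> mu) pi P -> controlled x_ a_ S nu N (fun=> nu) pi P.
Proof.
move=> munu [mx ma init action state]; split => //.
- by move=> B mB; rewrite init// munu.
- move=> t E B tN hE mB; rewrite state//; apply: eq_integral => w _.
  exact: (sys_eq_measure _ _ munu).2.
Qed.

Lemma expected_cost_eq_measure (mu nu : PX) beta N :
  (forall B, measurable B -> mu B = nu B) ->
  expected_cost x_ a_ S beta N (fun=> mu) P = expected_cost x_ a_ S beta N (fun=> nu) P.
Proof.
move=> munu; apply: eq_integral => w _; apply: eq_eseriesr => t _.
by rewrite (sys_eq_measure _ _ munu).1.
Qed.

Variables (mu : PX) (pi : policy x0 a0).
Hypothesis stationary : forall B, measurable B ->
  mu B = (\int[mu]_x \int[pi x]_a trans S x a mu B)%E.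
Hypothesis ctrl : controlled x_ a_ S mu None (fun=> mu) (fun=> pi) P.

(** If [x_ t] has law [mu], then [(x_ t, a_ t)] has law [joint pi mu], which [stationary] turns back
    into law [mu] at the next time. *)
Lemma law_stationary t B : measurable B -> P (x_ t @^-1` B) = mu B.
Proof.
have [mx ma init action state] := ctrl.
elim: t B => [|t IHt] B mB; first exact: init.
have mxa : measurable_fun setT (fun w => (x_ t w, a_ t w)).
  exact: measurable_fun_pair.
have [Q QE] := probability_pushforward P mxa.
have [Q1 Q1E] := probability_pushforward P (mx t).
have Q_joint C : measurable C -> Q C = joint pi mu C.
  apply: (@measure_unique _ R (BX * BA)%type
    [set A `*` B | A in measurable & B in measurable] (fun=> setT)).
  - exact: measurable_prod_measurableType.
  - move=> _ _ [A1 mA1 [B1 mB1 <-]] [A2 mA2 [B2 mB2 <-]]; rewrite -setXI.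
    by exists (A1 `&` A2); [exact: measurableI|exists (B1 `&` B2) => //; exact: measurableI].
  - by move=> _; exists setT => //; exists setT => //; rewrite setXTT.
  - by rewrite bigcup_const.
  - move=> _ [C1 mC1 [C2 mC2 <-]].
    apply: etrans (QE _ (measurableX mC1 mC2)) _.
    apply: etrans (action t (x_ t @^-1` C1) C2 _ _ mC2) _ => //.
      exact: history_state.
    apply: etrans (esym (joint_setX pi mu mC1 mC2)).
    transitivity (\int[Q1]_(x in C1) pi x C2)%E; last first.
      by apply: eq_measure_integral => C' mC' _; apply: etrans (Q1E _ mC') _; exact: IHt.
    rewrite (eq_measure_integral (pushforward P (x_ t))); last first.
      by move=> C' mC' _; exact: Q1E.
    rewrite ge0_integral_pushforward//.
    by apply: measurable_funTS; exact: measurable_kernel.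
  - by move=> _; apply: (@le_lt_trans _ _ 1%E); [exact: probability_le1|exact: ltry].
have mtr := measurable_trans mu mB.
(* The conditional law is read on the sure event, which lies in the history as the preimage of the
   whole space. *)
rewrite -[_ @^-1` _]setTI state//; last first.
  by rewrite -[setT](preimage_setT (x_ t)); exact: history_state.
rewrite stationary//.
rewrite -(@integral_joint _ _ _ _ _ pi mu (fun z => trans S z.1 z.2 mu B))//.
transitivity (\int[Q]_z trans S z.1 z.2 mu B)%E; last first.
  by apply: eq_measure_integral => C mC _; exact: Q_joint.
rewrite (eq_measure_integral (pushforward P (fun w => (x_ t w, a_ t w)))); last first.
  by move=> C mC _; exact: QE.
by rewrite ge0_integral_pushforward.
Qed.

(** The set where the policies differ on [B] is [mu]-null, so its preimage under [x_ t], a variable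
    of law [mu], is [P]-null. A null set depending on [B] suffices because [law_action] is tested
    one [B] at a time. *)
Lemma controlled_ae_policy (pi' : policy x0 a0) :
  (forall B, measurable B -> ae_eq mu setT (pi ^~ B) (pi' ^~ B)) ->
  controlled x_ a_ S mu None (fun=> mu) (fun=> pi') P.
Proof.
have [mx ma init action state] := ctrl.
move=> pipi'; split => // t E B tN hE mB; rewrite action//.
have mE := history_measurable mx ma hE.
have mpi (p : policy x0 a0) : measurable_fun E (fun w => p (x_ t w) B).
  apply: measurable_funTS.
  exact: (measurableT_comp (measurable_kernel p B mB) (mx t)).
apply: ae_eq_integral => //.
have [N [mN N0 pN]] := pipi' B mB.
exists (x_ t @^-1` N); split.
- by rewrite -[_ @^-1` _]setTI; exact: mx.
- exact: etrans (law_stationary t mN) N0.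
- by move=> w /= pw; apply: pN => /= ppE; apply: pw => _; exact: ppE.
Qed.

End controlled.

Lemma mfe_stationary_joint beta (pi pi' : policy x0 a0) (mu mu' : PX) :
  (forall C, measurable C -> joint pi' mu' C = joint pi mu C) ->
  mfe_stationary S beta pi' mu' -> mfe_stationary S beta pi mu.
Proof.
move=> jE [_ [v [d [Om [P [x_ [a_ [ctrl vE]]]]]] vmin] cons'].
have [mumu' pipi'] := joint_inj jE.
have mu'mu B : measurable B -> mu B = mu' B by move=> mB; rewrite mumu'.
have stat B : measurable B ->
    mu' B = (\int[mu']_x \int[pi' x]_a trans S x a mu' B)%E.
  exact: (cons' 0%N).
split => //.
- exists v.
    exists d, Om, P, x_, a_; split; last by rewrite vE; exact: expected_cost_eq_measure.
    apply: (controlled_eq_measure mumu'); exact: (controlled_ae_policy stat ctrl).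
  (* A competitor against [mu] is a competitor against [mu'] with the same cost, so minimality is
     inherited. *)
  move=> pi2 v2 [d2 [Om2 [P2 [x2 [a2 [ctrl2 ->]]]]]].
  apply: vmin; exists d2, Om2, P2, x2, a2; split; last exact: expected_cost_eq_measure.
  exact: (controlled_eq_measure mu'mu ctrl2).
move=> t _ B mB; rewrite mu'mu// stat//.
have mtr (nu : PX) := measurable_trans nu mB.
(* Both double integrals are integrals against a joint law, so the equality of joint laws applies at
   once. *)
rewrite -(@integral_joint _ _ _ _ _ pi' mu' (fun z => trans S z.1 z.2 mu' B))//.
rewrite -(@integral_joint _ _ _ _ _ pi mu (fun z => trans S z.1 z.2 mu B))//.
transitivity (\int[joint pi mu]_z trans S z.1 z.2 mu' B)%E.
  by apply: eq_measure_integral => C mC _; exact: jE.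
by apply: eq_integral => z _; rewrite (sys_eq_measure _ _ mumu').2.
Qed.

End game.

(** * Limits of equilibria *)

Lemma near_W1_lt (R : realType) d (Z : measurableType d) (dist : Z -> Z -> R)
    (u : nat -> probability Z R) (p : probability Z R) (e : R) : 0 < e ->
  W1 dist (u t) p @[t --> \oo] --> 0%E ->
  \forall t \near \oo, (W1 dist (u t) p < e%:E)%E.
Proof.
move=> e0 up; apply: (up [set x | x < e%:E]%E).
apply: open_nbhs_nbhs; split; last by rewrite /= lte_fin.
exact: open_ereal_lt_ereal.
Qed.

Lemma W1_lim_unique (R : realType) d (Z : topMeasurableType d)
    (dist : Z -> Z -> R) (u : nat -> probability Z R) (p q : probability Z R) :
  compact_metric dist -> W1 dist (u t) p @[t --> \oo] --> 0%E ->
  W1 dist (u t) q @[t --> \oo] --> 0%E ->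
  forall e, 0 < e -> (W1 dist p q < e%:E)%E.
Proof.
move=> cm up uq e e0; have e3 : 0 < e / 3 by rewrite divr_gt0.
near \oo => t.
have pt : (W1 dist p (u t) < (e / 3)%:E)%E.
  by rewrite W1_sym//; near: t; exact: near_W1_lt.
have tq : (W1 dist (u t) q < (e / 3)%:E)%E by near: t; exact: near_W1_lt.
by apply: le_lt_trans (W1_lt_triangle cm pt tq) _; rewrite lte_fin; lra.
Unshelve. all: by end_near.
Qed.

Lemma W1_lim_le (R : realType) d (Z : topMeasurableType d)
    (dist : Z -> Z -> R) (p_ q_ : nat -> probability Z R)
    (p q : probability Z R) (e c : R) :
  compact_metric dist -> W1 dist (p_ t) p @[t --> \oo] --> 0%E ->
  W1 dist (q_ t) q @[t --> \oo] --> 0%E ->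
  (forall t, (W1 dist (p_ t) (q_ t) <= e%:E)%E) -> 0 < c ->
  (W1 dist p q <= (e + c)%:E)%E.
Proof.
(* Two quarters cover the distances to the limits, two the passages from weak to strict bounds. *)
move=> cm pp qq pq c0; have c4 : 0 < c / 4 by rewrite divr_gt0.
have [t [pt qt]] : exists t, (W1 dist (p_ t) p < (c / 4)%:E)%E /\
    (W1 dist (q_ t) q < (c / 4)%:E)%E.
  by apply: (@filter_ex _ \oo); apply: filterS2 (near_W1_lt c4 pp) (near_W1_lt c4 qq).
rewrite (W1_sym _ _ cm) in pt.
have pqt : (W1 dist (p_ t) (q_ t) < (e + c / 4)%:E)%E.
  by apply: le_lt_trans (pq t) _; rewrite lte_fin; lra.
have pqt' : (W1 dist p (q_ t) < (e + 3 * (c / 4))%:E)%E.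
  by apply: le_lt_trans (W1_lt_triangle cm pt pqt) _; rewrite lte_fin; lra.
by apply: le_trans (W1_lt_triangle cm pqt' qt) _; rewrite lee_fin; lra.
Qed.

Section W1XA.
Context (R : realType) (X : metricType R) (x0 : X)
  (m : nat) (A : set 'rV[R]_m) (a0 : A).
Hypotheses (compactX : compact [set: X]) (compactA : compact A).
Local Notation XA := (borel x0 * borel a0)%type.

Lemma compact_metric_distXA : compact_metric (@distXA R X x0 m A a0).
Proof.
exact: compact_metric_prod (compact_metric_distX x0 compactX)
  (compact_metric_distA a0 compactA).
Qed.

Lemma W1XA_lim_unique (u : nat -> probability XA R) (p q : probability XA R) :
  W1XA (u t) p @[t --> \oo] --> 0%E -> W1XA (u t) q @[t --> \oo] --> 0%E ->
  forall C, measurable C -> p C = q C.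
Proof.
move=> up uq; apply: (W1_eq0_prod (compact_metric_distX x0 compactX)
  (compact_metric_distA a0 compactA)).
exact: (W1_lim_unique compact_metric_distXA up uq).
Qed.

Lemma W1XA_lim_le (p_ q_ : nat -> probability XA R) (p q : probability XA R)
    (e c : R) :
  W1XA (p_ t) p @[t --> \oo] --> 0%E -> W1XA (q_ t) q @[t --> \oo] --> 0%E ->
  (forall t, (W1XA (p_ t) (q_ t) <= e%:E)%E) -> 0 < c ->
  (W1XA p q <= (e + c)%:E)%E.
Proof. exact: (W1_lim_le compact_metric_distXA). Qed.

Lemma W1XA_weak_closed (u v : nat -> probability XA R) (p q : probability XA R)
    (e : R) :
  (u t : weak_probability XA R) @[t --> \oo] --> (p : weak_probability XA R) ->
  (v t : weak_probability XA R) @[t --> \oo] --> (q : weak_probability XA R) ->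
  (\forall t \near \oo, (W1XA (u t) (v t) < e%:E)%E) ->
  (W1XA p q <= e%:E)%E.
Proof. exact: (W1_weak_closed compact_metric_distXA). Qed.

End W1XA.

Lemma mfe_stationary_lim (R : realType) (X : metricType R) (x0 : X)
    (m : nat) (A : set 'rV[R]_m) (a0 : A) (S : system x0 A) (beta : R)
    (mu0 : probability (borel x0) R) (pi_ : nat -> policy x0 a0)
    (mu_ : nat -> probability (borel x0) R) (pi : policy x0 a0)
    (mu : probability (borel x0) R) :
  compact [set: X] -> compact A -> sys_continuous S ->
  asymp_discount_optimal S beta mu0 pi_ mu_ ->
  W1XA (joint (pi_ t) (mu_ t)) (joint pi mu) @[t --> \oo] --> 0%E ->
  mfe_stationary S beta pi mu.
Proof.
move=> cX cA Sc [_ [pi' [mu' [mfe' lim']]]] lim.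
apply: (mfe_stationary_joint cX cA Sc _ mfe').
exact: (W1XA_lim_unique cX cA lim' lim).
Qed.

(** Evaluation at [t] is continuous on the product, and for [T > t] the extension leaves time [t]
    untouched. *)
Lemma cvg_joint_flow (R : realType) (X : metricType R) (x0 : X)
    (m : nat) (A : set 'rV[R]_m) (a0 : A) (piT : nat -> nat -> policy x0 a0)
    (muT : nat -> nat -> probability (borel x0) R) (pi_ : nat -> policy x0 a0)
    (mu_ : nat -> probability (borel x0) R) t :
  joint_flow (extend_flow T (piT T)) (extend_flow T (muT T)) @[T --> \oo]
    --> joint_flow pi_ mu_ ->
  (joint (piT T t) (muT T t) : weak_probability (borel x0 * borel a0)%type R)
    @[T --> \oo] --> (joint (pi_ t) (mu_ t) : weak_probability (borel x0 * borel a0)%type R).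
Proof.
move=> /(ptws_cvg_eval (u := t)) flow_t.
apply: cvg_trans flow_t; apply: near_eq_cvg; exists t.+1 => // T /= tT.
by rewrite /joint_flow /extend_flow tT.
Qed.

(* [x0] and [a0] witness that [X] and [A] are nonempty. *)
Theorem corollary6 (R : realType) (X : metricType R) (x0 : X)
    (m : nat) (A : set 'rV[R]_m) (a0 : A)
    (compactX : compact [set: X])
    (compactA : compact A) (convexA : convex_set A)
    (beta : R) (beta_ge0 : 0 <= beta) (beta_lt1 : beta < 1)
    (mu0 : probability (borel x0) R)
    (S S' : system x0 A)
    (hS : sys_assumptions beta S) (hS' : sys_assumptions beta S')
    (piT piT' : nat -> nat -> policy x0 a0)
    (muT muT' : nat -> nat -> probability (borel x0) R)
    (mfeT : forall T, (0 < T)%N -> mfe_finite S beta mu0 T (piT T) (muT T))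
    (mfeT' : forall T, (0 < T)%N -> mfe_finite S' beta mu0 T (piT' T) (muT' T))
    (eps : R) (eps_gt0 : 0 < eps)
    (close : \forall T \near \oo, forall t, (t < T)%N ->
      (W1XA (joint (piT T t) (muT T t)) (joint (piT' T t) (muT' T t))
         < eps%:E)%E)
    (pi_ pi_' : nat -> policy x0 a0)
    (mu_ mu_' : nat -> probability (borel x0) R)
    (cvgT : joint_flow (extend_flow T (piT T)) (extend_flow T (muT T))
      @[T --> \oo] --> joint_flow pi_ mu_)
    (cvgT' : joint_flow (extend_flow T (piT' T)) (extend_flow T (muT' T))
      @[T --> \oo] --> joint_flow pi_' mu_')
    (ado : asymp_discount_optimal S beta mu0 pi_ mu_)
    (ado' : asymp_discount_optimal S' beta mu0 pi_' mu_')
    (pi pi' : policy x0 a0) (mu mu' : probability (borel x0) R)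
    (lim : W1XA (joint (pi_ t) (mu_ t)) (joint pi mu) @[t --> \oo] --> 0%E)
    (lim' : W1XA (joint (pi_' t) (mu_' t)) (joint pi' mu')
      @[t --> \oo] --> 0%E) :
  [/\ mfe_stationary S beta pi mu,
      mfe_stationary S' beta pi' mu' &
      (W1XA (joint pi mu) (joint pi' mu') < (3 * eps)%:E)%E].
Proof.
split.
- by case: hS => Sc _; exact: mfe_stationary_lim ado lim.
- by case: hS' => Sc _; exact: mfe_stationary_lim ado' lim'.
have closed_le t : (W1XA (joint (pi_ t) (mu_ t)) (joint (pi_' t) (mu_' t)) <= eps%:E)%E.
  apply: (W1XA_weak_closed compactX compactA (cvg_joint_flow (t := t) cvgT)
    (cvg_joint_flow (t := t) cvgT')).
  (* With [t] fixed, the restriction [t < T] in [close] holds for all large [T]. *)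
  by apply: filterS2 close (nbhs_infty_gt t) => T + tT; exact.
(* The slack is taken to be [eps] itself, so the bound is [eps + eps]. *)
apply: le_lt_trans (W1XA_lim_le compactX compactA lim lim' closed_le eps_gt0) _.
by rewrite lte_fin; lra.
Qed.
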